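(* For every integer $d\geq 5$ and every real $q$ with $-(d-4)\leq q<0$, we have $c_d(q)=c_{d,\infty}(q)$.
   Context: $|\cdot|$ is the standard Euclidean norm on $\mathbb{R}^d$. For a random vector $X$ in $\mathbb{R}^d$ and real $q\neq 0$, $\|X\|_q=(\mathbb{E}|X|^q)^{1/q}$. Let $\xi_1,\xi_2,\dots$ be independent random vectors, each uniform on the unit Euclidean sphere $S^{d-1}$ in $\mathbb{R}^d$. For $q>-(d-1)$, $c_d(q)$ denotes the best (largest) constant such that $\left\|\sum_{k=1}^n a_k\xi_k\right\|_q\geq c_d(q)\left\|\sum_{k=1}^n a_k\xi_k\right\|_2$ holds for every $n\geq 1$ and all real scalars $a_1,\dots,a_n$; equivalently, $c_d(q)$ is the infimum of $\left\|\sum_{k=1}^n a_k\xi_k\right\|_q$ over all $n\geq 1$ and all $a_1,\dots,a_n\in\mathbb{R}$ with $\sum_{k=1}^n a_k^2=1$. Moreover $$c_{d,\infty}(q)=\lim_{n\to\infty}\left\|\frac{\xi_1+\dots+\xi_n}{\sqrt n}\right\|_q=\left\|\frac{Z}{\sqrt d}\right\|_q=\sqrt{\frac{2}{d}}\left(\frac{\Gamma\left(\frac{d+q}{2}\right)}{\Gamma\left(\frac d2\right)}\right)^{1/q},$$ where $Z$ is a standard Gaussian random vector in $\mathbb{R}^d$. *)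

(* Defs.v *)
From HB Require Import structures.
From mathcomp Require Import all_boot all_order all_algebra finmap.
From mathcomp Require Import all_classical all_reals all_analysis.

Set Implicit Arguments.
Unset Strict Implicit.
Unset Printing Implicit Defensive.

Import Order.TTheory GRing.Theory Num.Theory.
Import numFieldNormedType.Exports.

Local Open Scope classical_set_scope.
Local Open Scope ring_scope.

(* The library norm on 'rV[R]_d is the sup norm. *)
Definition enorm (R : realType) (d : nat) (x : 'rV[R]_d) : R :=
  Num.sqrt (\sum_(i < d) x ord0 i ^+ 2).

(* R^d with its Borel sigma-algebra; the type unfolds to 'rV[R]_d. *)
Notation borel_vec R d := (g_sigma_algebraType (@open 'rV[R]_d)).

Definition sphere (R : realType) (d : nat) : set 'rV[R]_d :=
  [set x | enorm x = 1].

(* The uniform law on the sphere is the rotation-invariant Borel probability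
   measure carried by it; row vectors are acted on from the right. *)
Definition uniform_on_sphere (R : realType) (d : nat) (disp : measure_display)
    (T : measurableType disp) (P : probability T R)
    (X : T -> borel_vec R d) : Prop :=
  [/\ measurable_fun [set: T] X,
      P (X @^-1` @sphere R d) = 1%E &
      forall (O : 'M[R]_d), O *m O^T = 1%:M ->
      forall B : set (borel_vec R d), measurable B ->
        P [set w | B ((X w : 'rV[R]_d) *m O)] = P (X @^-1` B)].

Definition mutually_independent (R : realType) (d : nat)
    (disp : measure_display) (T : measurableType disp) (P : probability T R)
    (X : nat -> T -> borel_vec R d) : Prop :=
  forall (J : {fset nat}) (B : nat -> set (borel_vec R d)),
    (forall j, j \in J -> measurable (B j)) ->
    P (\bigcap_(j in [set` J]) (X j @^-1` B j)) =
    (\prod_(j <- J) P (X j @^-1` B j))%E.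

(* x ^ p for x in [0, +oo] and p != 0, with 0 ^ p = +oo and +oo ^ p = 0 when
   p < 0; the library's poweR has 0 `^ p = 0 and +oo `^ p = +oo there. *)
Definition epow (R : realType) (x : \bar R) (p : R) : \bar R :=
  (if (p < 0)%R then (poweR x (- p))^-1 else poweR x p)%E.

(* ||X||_p = (E |X|^p)^(1/p) *)
Definition qnorm (R : realType) (d : nat) (disp : measure_display)
    (T : measurableType disp) (P : probability T R) (p : R)
    (X : T -> 'rV[R]_d) : \bar R :=
  epow (\int[P]_w epow (enorm (X w))%:E p)%E p^-1.

Definition lin_comb (R : realType) (d : nat) (T : Type)
    (xi : nat -> T -> borel_vec R d) (n : nat) (a : nat -> R) (w : T) :
    'rV[R]_d :=
  \sum_(k < n) a k *: (xi k w : 'rV[R]_d).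

(* The scalars a are not normalized; for a = 0 both sides are 0, as
   ||0||_q = (+oo)^(1/q) = 0 for q < 0. *)
Definition khinchin_bound (R : realType) (d : nat) (disp : measure_display)
    (T : measurableType disp) (P : probability T R)
    (xi : nat -> T -> borel_vec R d) (q c : R) : Prop :=
  forall (n : nat) (a : nat -> R), (0 < n)%N ->
    (c%:E * qnorm P 2 (lin_comb xi n a) <= qnorm P q (lin_comb xi n a))%E.

Definition khinchin_const (R : realType) (d : nat) (disp : measure_display)
    (T : measurableType disp) (P : probability T R)
    (xi : nat -> T -> borel_vec R d) (q : R) : \bar R :=
  ereal_sup [set c%:E | c in [set c : R | khinchin_bound P xi q c]].

Definition normalized_norm (R : realType) (d : nat) (disp : measure_display)
    (T : measurableType disp) (P : probability T R)
    (xi : nat -> T -> borel_vec R d) (q : R) (n : nat) : \bar R :=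
  qnorm P q
    (fun w => (Num.sqrt n%:R)^-1 *: \sum_(k < n) (xi k w : 'rV[R]_d)).

Definition khinchin_const_infty (R : realType) (d : nat)
    (disp : measure_display) (T : measurableType disp) (P : probability T R)
    (xi : nat -> T -> borel_vec R d) (q : R) : \bar R :=
  limn (normalized_norm P xi q).

(* Main.v *)
(* With p = q/2 < 0 and e > 0, the function (e + |x|^2)^p is bisubharmonic on
   R^d because d + 2p >= 4. Its average over the sphere of radius a centred
   at v, seen as a function of r = a^2, is then convex. Freeze all the vectors of
   the sum except xi_i and xi_j: the expectation of (e + |V + S|^2)^p with
   S = a xi_i + b xi_j becomes, by rotation invariance, the expectation of such a
   convex function at |S|^2 = a^2 + b^2 + 2ab <xi_i, xi_j>, where <xi_i, xi_j> is
   symmetric; hence for fixed a^2 + b^2 it increases with |ab|. Robin Hood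
   transfers then show that among all coefficients with given sum of squares the
   equal ones maximize the expectation, and monotone convergence as e -> 0 turns
   this into the same statement for E|.|^q. So the norms ||.||_q are minimized by
   equal coefficients; padding with a zero coefficient shows that the normalized
   norms are nonincreasing in n, and their limit is the best constant. *)

(* For an average [F], as a function of the radius [a], convexity in [a^2] means [a F'' - F' >= 0];
   two integrations of the radial Laplacian from 0 derive this from a nonnegative bilaplacian.
   Expanding the bilaplacian of [(e + |x|^2)^p] in powers of [e + |x|^2] gives coefficients whose
   signs, for [p < 0], are governed by [d + 2p - 4]; with [p = q/2] this is the bound
   [-(d - 4) <= q].

   The uniform law is known only through rotation invariance: neither surface measure nor the
   density of a coordinate is at hand. Integration by parts on the sphere is therefore replaced by a
   Stein identity, obtained by differentiating an expectation that does not depend on the angle of a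
   reflection. With it, the differential equations for spherical averages become algebraic relations
   between moments. The shift [e > 0] keeps the integrands bounded for bounded [a], which allows
   differentiation under the integral.

   Freezing the other vectors is a Tonelli argument on a product law, one factor of which carries
   the sigma-algebra generated by all the other vectors. *)
Require Import Defs.
From HB Require Import structures.
From mathcomp Require Import all_boot all_order all_algebra finmap.
From mathcomp Require Import all_classical all_reals all_analysis.
From mathcomp Require Import measurable_realfun ring lra.

Set Implicit Arguments.
Unset Strict Implicit.
Unset Printing Implicit Defensive.

Import Order.TTheory GRing.Theory Num.Theory.
Import numFieldNormedType.Exports.

Local Open Scope classical_set_scope.
Local Open Scope ring_scope.

(** * Euclidean geometry of row vectors *)

Section Euclidean.
Variables (R : realType) (d : nat).
Implicit Types (x y z : 'rV[R]_d) (O : 'M[R]_d).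

Definition dot x y : R := \sum_(i < d) x ord0 i * y ord0 i.

Definition nsq x : R := \sum_(i < d) x ord0 i ^+ 2.

Lemma nsqE x : nsq x = dot x x.
Proof. by apply: eq_bigr => i _; rewrite expr2. Qed.

Lemma dotC x y : dot x y = dot y x.
Proof. by apply: eq_bigr => i _; rewrite mulrC. Qed.

Lemma dotDl x y z : dot (x + y) z = dot x z + dot y z.
Proof. by rewrite -big_split/=; apply: eq_bigr => i _; rewrite mxE mulrDl. Qed.

Lemma dotZl (a : R) x y : dot (a *: x) y = a * dot x y.
Proof. by rewrite mulr_sumr; apply: eq_bigr => i _; rewrite mxE mulrA. Qed.

Lemma dotDr x y z : dot x (y + z) = dot x y + dot x z.
Proof. by rewrite dotC dotDl !(dotC x). Qed.

Lemma dotZr (a : R) x y : dot x (a *: y) = a * dot x y.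
Proof. by rewrite dotC dotZl dotC. Qed.

Lemma dotNr x y : dot x (- y) = - dot x y.
Proof. by rewrite -scaleN1r dotZr mulN1r. Qed.

Lemma dotNl x y : dot (- x) y = - dot x y.
Proof. by rewrite dotC dotNr dotC. Qed.

Lemma nsqD x y : nsq (x + y) = nsq x + nsq y + 2 * dot x y.
Proof. by rewrite !nsqE dotDl !dotDr (dotC y x); ring. Qed.

Lemma nsqZ (a : R) x : nsq (a *: x) = a ^+ 2 * nsq x.
Proof. by rewrite !nsqE dotZl dotZr mulrA expr2. Qed.

Lemma nsq_ge0 x : 0 <= nsq x.
Proof. by apply: sumr_ge0 => i _; exact: sqr_ge0. Qed.

Lemma nsq_eq0 x : (nsq x == 0) = (x == 0).
Proof.
apply/eqP/eqP => [x0|->]; last by rewrite /nsq big1// => i _; rewrite mxE expr0n.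
apply/rowP => i; rewrite mxE; apply/eqP; rewrite -sqrf_eq0; apply/eqP.
by apply: (psumr_eq0P _ x0) => // j _; exact: sqr_ge0.
Qed.

Lemma coord_sqr_le_nsq x i : x ord0 i ^+ 2 <= nsq x.
Proof.
rewrite /nsq (bigD1 i)//= lerDl; apply: sumr_ge0 => j _; exact: sqr_ge0.
Qed.

Lemma dot_mulmx x y : dot x y = (x *m y^T) ord0 ord0.
Proof. by rewrite mxE; apply: eq_bigr => i _; rewrite mxE. Qed.

Lemma dot_mulO O x y : O *m O^T = 1%:M -> dot (x *m O) (y *m O) = dot x y.
Proof.
by move=> OO; rewrite !dot_mulmx trmx_mul mulmxA -(mulmxA x) OO mulmx1.
Qed.

Lemma nsq_mulO O x : O *m O^T = 1%:M -> nsq (x *m O) = nsq x.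
Proof. by move=> OO; rewrite !nsqE dot_mulO. Qed.

(* When [nsq n = 0] the division by zero makes this the identity. *)
Definition reflection (n : 'rV[R]_d) : 'M[R]_d :=
  1%:M - (2 / nsq n) *: (n^T *m n).

Lemma mul_reflection n x :
  x *m reflection n = x - (2 / nsq n * dot x n) *: n.
Proof.
rewrite /reflection mulmxBr mulmx1 -scalemxAr mulmxA.
rewrite (_ : x *m n^T = (dot x n)%:M) ?mul_scalar_mx ?scalerA//.
by rewrite dot_mulmx -mx11_scalar.
Qed.

Lemma reflectionK n : reflection n *m (reflection n)^T = 1%:M.
Proof.
have -> : (reflection n)^T = reflection n.
  by rewrite /reflection linearB/= linearZ/= trmx_mul trmxK trmx1.
apply/row_matrixP => i; rewrite -{1}(mul1mx (reflection n)) !row_mul.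
rewrite 2!mul_reflection.
set x := row i _; rewrite dotDl dotNl dotZl -nsqE.
have [n0|n0] := eqVneq (nsq n) 0.
  by rewrite n0 invr0 !mulr0 !mul0r scale0r !subr0.
rewrite -addrA -opprD -scalerDl.
(* The component along [n] changes sign under the first reflection, so the two corrections
   cancel. *)
have -> : 2 / nsq n * dot x n
    + 2 / nsq n * (dot x n - 2 / nsq n * dot x n * nsq n) = 0 by field.
by rewrite scale0r subr0.
Qed.

(** When [|x| = |y|], [|x - y|^2 = 2 <x, x - y>], so the reflection along [x - y] moves [x] by
    exactly [x - y]. *)
Lemma ex_orthogonal x y : nsq x = nsq y ->
  exists2 O, O *m O^T = 1%:M & x *m O = y.
Proof.
move=> xy; exists (reflection (x - y)); first exact: reflectionK.
have [n0|n0] := eqVneq (nsq (x - y)) 0.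
  rewrite mul_reflection n0 invr0 mulr0 mul0r scale0r subr0.
  by apply/eqP; rewrite -subr_eq0 -nsq_eq0 n0.
rewrite mul_reflection.
have -> : 2 / nsq (x - y) * dot x (x - y) = 1; last by rewrite scale1r subKr.
have e : nsq (x - y) = 2 * dot x (x - y).
  have := nsqD x (- y); rewrite dotDr -nsqE !dotNr.
  have -> : nsq (- y) = nsq y by rewrite -scaleN1r nsqZ sqrrN expr1n mul1r.
  by move=> ->; rewrite xy; ring.
by rewrite mulrAC -e divff.
Qed.

Lemma enormE x : enorm x = Num.sqrt (nsq x). Proof. by []. Qed.

Lemma sqr_enorm x : enorm x ^+ 2 = nsq x.
Proof. by rewrite sqr_sqrtr// nsq_ge0. Qed.

Lemma sphereP x : sphere x <-> nsq x = 1.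
Proof.
split=> [x1|x1]; first by rewrite -sqr_enorm x1 expr1n.
by rewrite /sphere/= enormE x1 sqrtr1.
Qed.

End Euclidean.

(** * Measurability through coordinates, and invariance of integrals under orthogonal maps *)

Lemma measurable_coord (R : realType) (d : nat) (i : 'I_d) :
  measurable_fun [set: borel_vec R d] (fun x => (x : 'rV[R]_d) ord0 i).
Proof.
apply: (measurability _ (measurable_realfun.RGenOpens.measurableE R)).
move=> _ [_ [a [b ->] <-]].
rewrite setTI; apply: sub_sigma_algebra.
apply: (@open_comp 'rV[R]_d R); last exact: interval_open.
by move=> x _; exact: coord_continuous.
Qed.

Lemma measurable_mulmxr (R : realType) (d : nat) (O : 'M[R]_d) :
  measurable_fun [set: borel_vec R d]
    (fun x => (x : 'rV[R]_d) *m O : borel_vec R d).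
Proof.
apply: (@measurability _ _ (borel_vec R d) (borel_vec R d) setT _
  (@open 'rV[R]_d) erefl) => _ [U oU <-].
rewrite setTI; apply: sub_sigma_algebra.
apply: (@open_comp 'rV[R]_d 'rV[R]_d (fun x => x *m O)) => //.
move=> x _; rewrite (_ : (fun y => y *m O) =
    (fun y : 'rV[R]_d => \sum_k y ord0 k *: row k O)); last first.
  by apply/funext => y; rewrite mulmx_sum_row.
apply: continuous_big => [|k _ y]; first exact: add_continuous.
by apply: (@cvgZr_tmp _ _ _ (nbhs y)); exact: coord_continuous.
Qed.

Section CoordinateMeasurable.
Context {disp} {T : measurableType disp} {R : realType} {d : nat}.
Implicit Types X Y : T -> 'rV[R]_d.

(** Tracking real coordinates makes sums and multiples immediate, for any sigma-algebra on the
    source, without Borel measurability of the vector operations. The integrands see the vectors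
    through [nsq], which [measurable_nsq] covers. *)
Definition coord_measurable X :=
  forall i, measurable_fun [set: T] (fun w => X w ord0 i).

Lemma coord_measurable_cst x : coord_measurable (fun=> x).
Proof. by move=> i; exact: measurable_cst. Qed.

Lemma coord_measurableD X Y : coord_measurable X -> coord_measurable Y ->
  coord_measurable (fun w => X w + Y w).
Proof.
move=> mX mY i; under eq_fun do rewrite mxE.
exact: measurable_funD.
Qed.

Lemma coord_measurableZ (a : R) X : coord_measurable X ->
  coord_measurable (fun w => a *: X w).
Proof.
move=> mX i; under eq_fun do rewrite mxE.
exact: measurable_funM.
Qed.

Lemma coord_measurable_sum (I : Type) (r : seq I) (Q : pred I)
    (F : I -> T -> 'rV[R]_d) :
  (forall k, Q k -> coord_measurable (F k)) ->
  coord_measurable (fun w => \sum_(k <- r | Q k) F k w).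
Proof.
move=> mF; elim: r => [|k r IH].
  by under eq_fun do rewrite big_nil; exact: coord_measurable_cst.
under eq_fun do rewrite big_cons.
by case: (boolP (Q k)) => // Qk; apply: coord_measurableD => //; exact: mF.
Qed.

Lemma measurable_nsq X : coord_measurable X ->
  measurable_fun [set: T] (fun w => nsq (X w)).
Proof.
by move=> mX; apply: measurable_sum => i; apply: measurable_funX; exact: mX.
Qed.

Lemma coord_measurable_vec (X : T -> borel_vec R d) :
  measurable_fun [set: T] X -> coord_measurable X.
Proof.
by move=> mX i; apply: (measurableT_comp (@measurable_coord R d i) mX).
Qed.

End CoordinateMeasurable.

Lemma coord_measurable_comp {d1 d2} {T1 : measurableType d1}
    {T2 : measurableType d2} {R : realType} {d : nat} (X : T2 -> 'rV[R]_d)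
    (f : T1 -> T2) :
  measurable_fun [set: T1] f -> coord_measurable X ->
  coord_measurable (X \o f).
Proof. by move=> mf mX i; apply: (measurableT_comp (mX i) mf). Qed.

Section Uniform.
Context {disp} {T : measurableType disp} {R : realType} {d : nat}.
Variables (P : probability T R) (X : T -> borel_vec R d).
Hypothesis uX : uniform_on_sphere P X.

(** Both sides integrate [h] against image measures of [P], and these agree by the invariance clause
    of [uniform_on_sphere]. *)
Lemma ge0_integral_uniform_mulO (O : 'M[R]_d) (h : borel_vec R d -> \bar R) :
  O *m O^T = 1%:M -> measurable_fun [set: borel_vec R d] h ->
  (forall x, 0 <= h x)%E ->
  (\int[P]_w h ((X w : 'rV[R]_d) *m O) = \int[P]_w h (X w))%E.
Proof.
move=> OO mh h0; have [mX _ rX] := uX.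
pose XO := fun w => (X w : 'rV[R]_d) *m O : borel_vec R d.
have mXO : measurable_fun setT XO.
  exact: (measurableT_comp (measurable_mulmxr O) mX).
transitivity (\int[pushforward P XO]_x h x)%E.
  by rewrite ge0_integral_pushforward.
transitivity (\int[pushforward P X]_x h x)%E.
  by apply: eq_measure_integral => A mA _; rewrite /pushforward; exact: rX.
by rewrite ge0_integral_pushforward.
Qed.

Lemma integral_uniform_mulO (O : 'M[R]_d) (h : borel_vec R d -> \bar R) :
  O *m O^T = 1%:M -> measurable_fun [set: borel_vec R d] h ->
  (\int[P]_w h ((X w : 'rV[R]_d) *m O) = \int[P]_w h (X w))%E.
Proof.
move=> OO mh; rewrite integralE [RHS]integralE; congr (_ - _)%E.
  under eq_integral do rewrite (funepos_comp h (fun w => _ *m O)).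
  under [RHS]eq_integral do rewrite (funepos_comp h X).
  rewrite /comp/= ge0_integral_uniform_mulO//; exact: measurable_funepos.
under eq_integral do rewrite (funeneg_comp h (fun w => _ *m O)).
under [RHS]eq_integral do rewrite (funeneg_comp h X).
rewrite /comp/= ge0_integral_uniform_mulO//; exact: measurable_funeneg.
Qed.

Lemma Rintegral_uniform_mulO (O : 'M[R]_d) (h : borel_vec R d -> R) :
  O *m O^T = 1%:M -> measurable_fun [set: borel_vec R d] h ->
  \int[P]_w h ((X w : 'rV[R]_d) *m O) = \int[P]_w h (X w).
Proof.
move=> OO mh; congr fine.
by apply: (@integral_uniform_mulO O (EFin \o h)) => //; exact/measurable_EFinP.
Qed.

End Uniform.

(** * Radial bisubharmonic functions in one variable *)

Section PointwiseDerivatives.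
Context {R : realType}.
Implicit Types (f g : R -> R) (x df dg c : R).

Lemma is_derive_const c x : is_derive x 1 (fun=> c : R) 0.
Proof. exact: is_derive_cst. Qed.

Lemma is_derive_add f g x df dg : is_derive x 1 f df -> is_derive x 1 g dg ->
  is_derive x 1 (fun y => f y + g y) (df + dg).
Proof. exact: is_deriveD. Qed.

Lemma is_derive_sub f g x df dg : is_derive x 1 f df -> is_derive x 1 g dg ->
  is_derive x 1 (fun y => f y - g y) (df - dg).
Proof. exact: is_deriveB. Qed.

Lemma is_derive_mul f g x df dg : is_derive x 1 f df -> is_derive x 1 g dg ->
  is_derive x 1 (fun y => f y * g y) (df * g x + f x * dg).
Proof.
move=> hf hg; apply: is_derive_eq (is_deriveM hf hg) _.
by rewrite /GRing.scale/= addrC [g x * _]mulrC.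
Qed.

Lemma is_derive_scale c f x df : is_derive x 1 f df ->
  is_derive x 1 (fun y => c * f y) (c * df).
Proof.
move=> hf; apply: is_derive_eq (is_derive_mul (is_derive_cst c x 1) hf) _.
by rewrite mul0r add0r.
Qed.

Lemma is_derive_pow n x : is_derive x 1 (fun y : R => y ^+ n) (n%:R * x ^+ n.-1).
Proof.
elim: n => [|n IH]; first by rewrite mul0r; exact: is_derive_cst.
under eq_fun do rewrite exprS.
apply: is_derive_eq (is_derive_mul (is_derive_id x 1) IH) _.
by case: n {IH} => [|n]; rewrite /= ?mul0r ?mulr0 ?exprS; ring.
Qed.

Lemma is_derive_compose f g x df dg :
  is_derive (g x) 1 f df -> is_derive x 1 g dg ->
  is_derive x 1 (fun y => f (g y)) (df * dg).
Proof. exact: is_derive1_comp. Qed.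

Lemma is_derive_continuous f x df : is_derive x 1 f df -> {for x, continuous f}.
Proof. by case=> h _; apply/differentiable_continuous/derivable1_diffP. Qed.

Lemma ge0_is_derive_le f f' (a b : R) : a <= b ->
  (forall x, a < x < b -> is_derive x 1 f (f' x)) ->
  (forall x, a < x < b -> 0 <= f' x) ->
  (forall x, a <= x <= b -> {for x, continuous f}) ->
  f a <= f b.
Proof.
move=> ab df f'0 cf.
apply: (@ger0_derive1_le_cc _ f a b); rewrite ?in_itv/= ?lexx ?ab//.
- by move=> x; rewrite in_itv/= => /df[].
- move=> x; rewrite in_itv/= => axb; rewrite derive1E.
  by have [_ ->] := df _ axb; exact: f'0.
- apply: continuous_in_subspaceT => x; rewrite inE/= in_itv/=; exact: cf.
Qed.

Lemma ge0_of_derive_ge0 f f' : (forall x, is_derive x 1 f (f' x)) -> f 0 = 0 ->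
  (forall x, 0 <= x -> 0 <= f' x) -> forall x, 0 <= x -> 0 <= f x.
Proof.
move=> df f0 f'0 x x0; rewrite -f0; apply: (@ge0_is_derive_le f f') => //.
- by move=> y /andP[/ltW y0 _]; exact: f'0.
- by move=> y _; exact: is_derive_continuous (df y).
Qed.

End PointwiseDerivatives.

Section Darboux.
Context {R : realType}.
Variables (m : nat) (F F1 F2 G G1 G2 L : R -> R).
Hypotheses (dF1 : forall a : R, is_derive a 1 F1 (F2 a))
  (dG : forall a : R, is_derive a 1 G (G1 a))
  (dG1 : forall a : R, is_derive a 1 G1 (G2 a)).
Hypotheses
  (FG : forall a, a * F2 a + m.+1%:R * F1 a = a * G a)
  (GL : forall a, a * G2 a + m.+1%:R * G1 a = a * L a)
  (L0 : forall a : R, 0 <= a -> 0 <= L a).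

(* In terms of the radial Laplacian in dimension [m + 2]: [F] has Laplacian
   [G], and [G] has Laplacian [L >= 0]; both conclusions come from
   [(a^(m+1) G')' = a^(m+1) L] and
   [(a^(m+2) G - (m+2) a^(m+1) F')' = a^(m+2) G']. *)
Lemma radial_bisubharmonic_convex a : 0 < a -> 0 <= a * F2 a - F1 a.
Proof.
have G1_ge0 x : 0 < x -> 0 <= G1 x.
  move=> x0; rewrite -(pmulr_rge0 _ (exprn_gt0 m.+1 x0)).
  apply: (@ge0_of_derive_ge0 _ (fun x => x ^+ m.+1 * G1 x)
     (fun x => x ^+ m.+1 * L x)); last exact: ltW.
  - move=> y; apply: is_derive_eq (is_derive_mul (is_derive_pow m.+1 y) (dG1 y)) _.
    apply/eqP; rewrite -subr_eq0; apply/eqP; rewrite /= !exprS.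
    transitivity (y ^+ m * (y * G2 y + m.+1%:R * G1 y - y * L y)).
      by ring.
    by rewrite GL subrr mulr0.
  - by rewrite expr0n/= mul0r.
  - by move=> y y0; rewrite mulr_ge0 ?exprn_ge0 ?L0.
have H0 x : 0 <= x -> 0 <= x ^+ m.+2 * G x - m.+2%:R * (x ^+ m.+1 * F1 x).
  apply: (@ge0_of_derive_ge0 _
    (fun x => x ^+ m.+2 * G x - m.+2%:R * (x ^+ m.+1 * F1 x))
    (fun x => x ^+ m.+2 * G1 x)).
  - move=> y; apply: is_derive_eq (is_derive_sub
      (is_derive_mul (is_derive_pow m.+2 y) (dG y))
      (is_derive_scale m.+2%:R
        (is_derive_mul (is_derive_pow m.+1 y) (dF1 y)))) _.
    apply/eqP; rewrite -subr_eq0; apply/eqP; rewrite /= !exprS.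
    transitivity (m.+2%:R * y ^+ m * (y * G y - (y * F2 y + m.+1%:R * F1 y))).
      by ring.
    by rewrite FG subrr mulr0.
  - by rewrite !expr0n/= !mul0r mulr0 subrr.
  - move=> y; rewrite le_eqVlt => /predU1P[<-|y0].
      by rewrite expr0n/= mul0r.
    by rewrite mulr_ge0 ?exprn_ge0 ?G1_ge0// ltW.
(* By [FG], the quantity bounded in [H0] equals [a ^+ m.+1 * (a * F2 a - F1 a)]. *)
move=> a0; rewrite -(pmulr_rge0 _ (exprn_gt0 m.+1 a0)).
apply: le_trans (H0 _ (ltW a0)) _; rewrite le_eqVlt; apply/orP; left.
by rewrite exprSr -[a ^+ m.+1 * a * G a]mulrA -FG; apply/eqP; ring.
Qed.

End Darboux.

Section ConvexSqrt.
Context {R : realType}.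
Variables F F1 F2 : R -> R.
Hypotheses (dF : forall a : R, is_derive a 1 F (F1 a))
  (dF1 : forall a : R, is_derive a 1 F1 (F2 a))
  (F2F1 : forall a : R, 0 < a -> 0 <= a * F2 a - F1 a).

(** In the variable [r = a ^+ 2], [F1 a / a] is twice the derivative of [F]; its monotonicity is
    convexity in [r]. *)
Let slope_mono (a b : R) : 0 < a -> a <= b -> F1 a / a <= F1 b / b.
Proof.
move=> a0 ab.
have d x : a <= x -> is_derive x 1 (fun x => F1 x / x)
    ((x * F2 x - F1 x) / x ^+ 2).
  move=> ax; have x0 : x != 0 by rewrite gt_eqF// (lt_le_trans a0).
  apply: is_derive_eq (is_derive_mul (dF1 x) (is_deriveV x0 (is_derive_id x 1))) _.
  by rewrite /GRing.scale/= mulr1; field.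
apply: (@ge0_is_derive_le _ (fun x => F1 x / x)
  (fun x => (x * F2 x - F1 x) / x ^+ 2)) => //.
- by move=> x /andP[/ltW ax _]; exact: d.
- by move=> x /andP[ax _]; rewrite divr_ge0 ?F2F1 ?sqr_ge0// (lt_trans a0).
- by move=> x /andP[ax _]; exact: is_derive_continuous (d _ ax).
Qed.

(** With [psi r = F (sqrt r)], the derivative of [psi (s + t) + psi (s - t)] in [t] is
    [psi' (s + t) - psi' (s - t)], nonnegative by [slope_mono]. *)
Lemma sqrt_comp_convex (s x y : R) : 0 <= x -> x <= y -> y <= s ->
  F (Num.sqrt (s + x)) + F (Num.sqrt (s - x)) <=
  F (Num.sqrt (s + y)) + F (Num.sqrt (s - y)).
Proof.
move=> x0 xy ys.
pose psi (r : R) := F (Num.sqrt r).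
have dpsi (r : R) : 0 < r -> is_derive r 1 psi (F1 (Num.sqrt r) / Num.sqrt r / 2).
  move=> r0; apply: is_derive_eq (is_derive_compose (dF _) (is_derive1_sqrt r0)) _.
  by rewrite invfM mulrA mulrAC.
(* For [y = s] the interval ends where [s - t = 0] and the square root has no derivative; continuity
   is enough there. *)
have cpsi : continuous psi.
  move=> r; apply: (@continuous_comp R R R Num.sqrt F).
    exact: sqrt_continuous.
  exact: is_derive_continuous (dF _).
have dD (t : R) : x < t < y -> is_derive t 1 (fun t => psi (s + t) + psi (s - t))
   (F1 (Num.sqrt (s + t)) / Num.sqrt (s + t) / 2 -
    F1 (Num.sqrt (s - t)) / Num.sqrt (s - t) / 2).
  move=> /andP[xt ty].
  have st : 0 < s - t by rewrite subr_gt0 (lt_le_trans ty).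
  have st' : 0 < s + t by lra.
  apply: is_derive_eq (is_derive_add
     (is_derive_compose (g := fun t => s + t) (dpsi _ st')
       (is_derive_add (is_derive_cst s t 1) (is_derive_id t 1)))
     (is_derive_compose (g := fun t => s - t) (dpsi _ st)
       (is_derive_sub (is_derive_cst s t 1) (is_derive_id t 1)))) _.
  by ring.
apply: (ge0_is_derive_le xy dD).
- move=> t /andP[xt ty]; rewrite subr_ge0 ler_pM2r ?invr_gt0//.
  have t0 : 0 < t := le_lt_trans x0 xt.
  apply: slope_mono; first by rewrite sqrtr_gt0 subr_gt0 (lt_le_trans ty).
  rewrite ler_wsqrtr// lerD2l; lra.
- move=> t _; apply: continuousD.
    apply: (@continuous_comp R R R (fun t => s + t) psi); last exact: cpsi.
    by apply: cvgD; [exact: cvg_cst|exact: cvg_id].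
  apply: (@continuous_comp R R R (fun t => s - t) psi); last exact: cpsi.
  by apply: cvgB; [exact: cvg_cst|exact: cvg_id].
Qed.

End ConvexSqrt.

(** * Moments of a coordinate of a uniform vector *)

Section BoundedExpectation.
Context {disp} {T : measurableType disp} {R : realType} (P : probability T R).

Lemma bounded_integrable (f : T -> R) (K : R) :
  measurable_fun [set: T] f -> (forall w, `|f w| <= K) ->
  P.-integrable [set: T] (EFin \o f).
Proof.
move=> mf fK; apply: measurable_bounded_integrable => //.
  by apply: (le_lt_trans (probability_le1 P measurableT)); rewrite ltry.
exists K; split; first exact: num_real.
by move=> M KM w _; exact: le_trans (fK w) (ltW KM).
Qed.

(** On a probability space a constant is an integrable dominating function, so uniform bounds near
    [a] suffice. *)
Lemma is_derive_Rintegral (f f' : R -> T -> R) (K a : R) :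
  (forall x, a - 1 < x < a + 1 -> measurable_fun [set: T] (f x)) ->
  (forall x w, a - 1 < x < a + 1 -> `|f x w| <= K) ->
  (forall x w, a - 1 < x < a + 1 -> is_derive x 1 (f^~ w) (f' x w)) ->
  (forall x w, a - 1 < x < a + 1 -> `|f' x w| <= K) ->
  is_derive a 1 (fun x => \int[P]_w f x w) (\int[P]_w f' a w).
Proof.
move=> mf fK df f'K.
have Ia : `]a - 1, a + 1[%classic a by rewrite /= in_itv/=; lra.
have d1 x w : a - 1 < x < a + 1 -> partial1of2 f x w = f' x w.
  by move=> xa; rewrite partial1of2E; have [_ ->] := df x w xa.
have K0 (w : T) : 0 <= K.
  by apply: le_trans (normr_ge0 _) (fK a w _); move: Ia; rewrite /= in_itv.
have intf x : `]a - 1, a + 1[%classic x -> P.-integrable [set: T] (EFin \o f x).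
  rewrite /= in_itv/= => xa.
  by apply: (@bounded_integrable _ K); [exact: mf|move=> w; exact: fK].
have derf x w : `]a - 1, a + 1[%classic x -> [set: T] w -> derivable (f^~ w) x 1.
  by rewrite /= in_itv/= => xa _; have [] := df x w xa.
have intK : P.-integrable [set: T] (EFin \o (fun=> `|K|)).
  by apply: (@bounded_integrable _ `|K|) => // w; rewrite normr_id.
have f'K' x w : `]a - 1, a + 1[%classic x -> [set: T] w ->
    `|partial1of2 f x w| <= `|K|.
  by rewrite /= in_itv/= => xa _; rewrite d1// (le_trans (f'K x w xa))// ler_norm.
apply: DeriveDef.
  exact: (derivable_under_integral measurableT Ia intf derf _ intK f'K').
rewrite -derive1E.
rewrite (differentiation_under_integral measurableT Ia intf derf _ intK f'K')//.
by apply: eq_Rintegral => w _; rewrite d1//; move: Ia; rewrite /= in_itv.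
Qed.

Lemma Rintegral_sum (I : Type) (r : seq I) (Q : pred I) (F : I -> T -> R) :
  (forall i, Q i -> P.-integrable [set: T] (EFin \o F i)) ->
  \int[P]_w (\sum_(i <- r | Q i) F i w) = \sum_(i <- r | Q i) \int[P]_w F i w.
Proof.
move=> iF; elim: r => [|i r IH].
  under eq_Rintegral do rewrite big_nil.
  by rewrite big_nil Rintegral_cst// mul0r.
under eq_Rintegral do rewrite big_cons.
rewrite big_cons; case: ifPn => // Qi.
rewrite RintegralD// ?IH//; first exact: iF.
rewrite (_ : _ \o _ = fun w => (\sum_(i <- r | Q i) (F i w)%:E)%E).
  exact: integrable_sum.
by apply/funext => w; rewrite /= sumEFin.
Qed.

End BoundedExpectation.

Section Stein.
Context {disp} {T : measurableType disp} {R : realType} {d : nat}.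
Variables (P : probability T R) (X : T -> borel_vec R d) (i0 : 'I_d).
Hypotheses (uX : uniform_on_sphere P X) (sX : forall w, nsq (X w) = 1).

Let cX i w : R := (X w : 'rV[R]_d) ord0 i.

Lemma sphere_coord_le1 i w : `|cX i w| <= 1.
Proof.
rewrite -[leRHS]normr1 -ler_sqr ?nnegrE// !real_normK ?num_real// expr1n.
by rewrite -(sX w) coord_sqr_le_nsq.
Qed.

Variables (g g' : R -> R) (K : R).
Hypotheses (dg : forall x : R, -1 <= x <= 1 -> is_derive x 1 g (g' x))
  (gK : forall x, -1 <= x <= 1 -> `|g x| <= K)
  (g'K : forall x, -1 <= x <= 1 -> `|g' x| <= K)
  (mg : measurable_fun [set: R] g) (mg' : measurable_fun [set: R] g').

Let mc i : measurable_fun [set: T] (cX i).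
Proof. by case: uX => mX _ _; exact: (coord_measurable_vec mX). Qed.

(* The derivative at h = 0 of E[Y_k g(Y_0)], where Y is the reflection of X in
   the hyperplane orthogonal to [sin h e_0 - cos h e_k]. *)
Let stein_coord k : k != i0 ->
  \int[P]_w (cX i0 w * g (cX i0 w)) = \int[P]_w (cX k w ^+ 2 * g' (cX i0 w)).
Proof.
move=> ki.
(* [Q] and [N] are the coordinates [i0] and [k] of the reflected vector, with coefficients [cos 2h],
   [sin 2h] and [sin 2h], [- cos 2h]; [dQ] and [dN] are their derivatives in [h]. *)
pose Q (h : R) w := (1 - 2 * (sin h * sin h)) * cX i0 w
  + 2 * (sin h * cos h) * cX k w.
pose N (h : R) w := 2 * (sin h * cos h) * cX i0 w
  + (1 - 2 * (cos h * cos h)) * cX k w.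
pose dQ (h : R) w := - (4 * (sin h * cos h)) * cX i0 w
  + 2 * (cos h * cos h - sin h * sin h) * cX k w.
pose dN (h : R) w := 2 * (cos h * cos h - sin h * sin h) * cX i0 w
  + 4 * (sin h * cos h) * cX k w.
pose n (h : R) : 'rV[R]_d :=
  sin h *: delta_mx ord0 i0 - cos h *: delta_mx ord0 k.
have dotd (x : 'rV[R]_d) i : dot x (delta_mx ord0 i) = x ord0 i.
  rewrite /dot (bigD1 i)//= mxE !eqxx mulr1 big1 ?addr0// => j ji.
  by rewrite mxE (negbTE ji) mulr0.
have dn x h : dot x (n h) = sin h * x ord0 i0 - cos h * x ord0 k.
  by rewrite dotDr dotNr !dotZr !dotd.
have n0 h : n h ord0 i0 = sin h.
  by rewrite !mxE !eqxx [i0 == k]eq_sym (negbTE ki) mulr0 subr0 mulr1.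
have nk h : n h ord0 k = - cos h.
  by rewrite !mxE !eqxx (negbTE ki) mulr0 sub0r mulr1.
have nn h : nsq (n h) = 1.
  by rewrite nsqE dn n0 nk mulrN opprK -!expr2 addrC cos2Dsin2.
have XQ h w : ((X w : 'rV[R]_d) *m reflection (n h)) ord0 i0 = Q h w.
  by rewrite mul_reflection nn divr1 dn mxE [X in _ + X]mxE [X in - X]mxE
    n0 /Q /cX; ring.
have XN h w : ((X w : 'rV[R]_d) *m reflection (n h)) ord0 k = N h w.
  by rewrite mul_reflection nn divr1 dn mxE [X in _ + X]mxE [X in - X]mxE
    nk /N /cX; ring.
have le1 (x : 'rV[R]_d) i : nsq x = 1 -> `|x ord0 i| <= 1.
  move=> x1; rewrite -[leRHS]normr1 -ler_sqr ?nnegrE// !real_normK ?num_real//.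
  by rewrite expr1n -x1 coord_sqr_le_nsq.
have sXO h w : nsq ((X w : 'rV[R]_d) *m reflection (n h)) = 1.
  by rewrite nsq_mulO ?sX//; exact: reflectionK.
have Q1 h w : `|Q h w| <= 1 by rewrite -XQ le1.
have Q1' h w : -1 <= Q h w <= 1 by rewrite -ler_norml.
have N1 h w : `|N h w| <= 1 by rewrite -XN le1.
have derQ (h : R) w : is_derive h 1 (Q^~ w) (dQ h w).
  have D := (is_derive_add
    (is_derive_mul (is_derive_sub (is_derive_const 1 h)
      (is_derive_scale 2 (is_derive_mul (is_derive_sin h) (is_derive_sin h))))
      (is_derive_const (cX i0 w) h))
    (is_derive_mul
      (is_derive_scale 2 (is_derive_mul (is_derive_sin h) (is_derive_cos h)))
      (is_derive_const (cX k w) h))).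
  apply: is_derive_eq D _.
  by rewrite /dQ; ring.
have derN (h : R) w : is_derive h 1 (N^~ w) (dN h w).
  have D := (is_derive_add
    (is_derive_mul
      (is_derive_scale 2 (is_derive_mul (is_derive_sin h) (is_derive_cos h)))
      (is_derive_const (cX i0 w) h))
    (is_derive_mul (is_derive_sub (is_derive_const 1 h)
      (is_derive_scale 2 (is_derive_mul (is_derive_cos h) (is_derive_cos h))))
      (is_derive_const (cX k w) h))).
  apply: is_derive_eq D _.
  by rewrite /dN; ring.
have sc1 (h : R) : `|sin h * cos h| <= 1.
  rewrite normrM mulr_ile1//; rewrite ler_norml ?cos_geN1 ?cos_le1//.
  by rewrite sin_geN1 sin_le1.
have cs1 (h : R) : `|cos h * cos h - sin h * sin h| <= 1.
  have := cos2Dsin2 h; have := sqr_ge0 (cos h); have := sqr_ge0 (sin h).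
  by rewrite ler_norml !expr2 => ? ? ?; lra.
have c1 i w := sphere_coord_le1 i w.
have b6 (a b x y : R) : `|a| <= 1 -> `|b| <= 1 -> `|x| <= 1 -> `|y| <= 1 ->
    `|4 * a * x + 2 * b * y| <= 6.
  move=> a1 b1 x1 y1; apply: (le_trans (ler_normD _ _)).
  rewrite !normrM !normr_nat -!mulrA.
  have := mulr_ile1 (normr_ge0 a) (normr_ge0 x) a1 x1.
  by have := mulr_ile1 (normr_ge0 b) (normr_ge0 y) b1 y1; lra.
have dQ6 h w : `|dQ h w| <= 6.
  have := b6 (- (sin h * cos h)) _ _ _ _ (cs1 h) (c1 i0 w) (c1 k w).
  by rewrite normrN mulrN => /(_ (sc1 h)).
have dN6 h w : `|dN h w| <= 6.
  have := b6 _ _ _ _ (sc1 h) (cs1 h) (c1 k w) (c1 i0 w).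
  by rewrite addrC.
have [w0 _] : exists w : T, True.
  by exists point.
have K0 : 0 <= K by apply: le_trans (gK _); [exact: normr_ge0|exact: (Q1' 0 w0)].
pose f h w := N h w * g (Q h w).
pose f' h w := dN h w * g (Q h w) + N h w * (g' (Q h w) * dQ h w).
have mlin (a b : R) : measurable_fun [set: T] (fun w => a * cX i0 w + b * cX k w).
  by apply: measurable_funD; apply: measurable_funM.
(* [12 * K] bounds both [f] and [f']: [|dN|, |dQ| <= 6], [|N| <= 1], and [g], [g'] are bounded by
   [K]. *)
have F' : is_derive (0 : R) 1 (fun h => \int[P]_w f h w) (\int[P]_w f' 0 w).
  apply: (@is_derive_Rintegral _ _ _ _ _ _ (12 * K)) => /=.
  - move=> h _; apply: measurable_funM; first exact: mlin.
    by apply: measurableT_comp => //; exact: mlin.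
  - move=> h w _; rewrite normrM -[leRHS]mul1r.
    by rewrite ler_pM// (le_trans (gK (Q1' h w)))//; lra.
  - move=> h w _; apply: is_derive_mul (derN h w) _.
    exact: (@is_derive_compose R g (Q^~ w) h _ _ (dg (Q1' h w)) (derQ h w)).
  - move=> h w _; apply: (le_trans (ler_normD _ _)); rewrite !normrM.
    rewrite (_ : 12 * K = 6 * K + 1 * (K * 6)); last by ring.
    by apply: lerD; do ?apply: ler_pM => //; rewrite ?gK ?g'K.
(* Invariance under the reflection makes the expectation independent of [h], so its derivative
   vanishes. *)
have Fcst : (fun h => \int[P]_w f h w) =
    (fun=> \int[P]_w (cX k w * g (cX i0 w))).
  apply/funext => h.
  rewrite -(@Rintegral_uniform_mulO _ _ _ _ P X uX (reflection (n h))
    (fun x => (x : 'rV[R]_d) ord0 k * g ((x : 'rV[R]_d) ord0 i0))).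
  - by apply: eq_Rintegral => w _; rewrite XQ XN.
  - exact: reflectionK.
  - apply: measurable_funM; first exact: measurable_coord.
    by apply: measurableT_comp => //; exact: measurable_coord.
have : \int[P]_w f' 0 w = 0.
  by case: F' => _ <-; rewrite Fcst; exact: derive_cst.
(* At [h = 0]: [Q = cX i0], [N = - cX k], [dQ = 2 * cX k] and [dN = 2 * cX i0]. *)
have -> : \int[P]_w f' 0 w = \int[P]_w
    (2 * (cX i0 w * g (cX i0 w) - cX k w ^+ 2 * g' (cX i0 w))).
  apply: eq_Rintegral => w _; rewrite /f' /N /dN /dQ /Q sin0 cos0.
  by rewrite !(mul0r, mulr0, mul1r, mulr1, subr0, addr0, add0r, oppr0); ring.
have i1 : P.-integrable [set: T] (EFin \o (fun w => cX i0 w * g (cX i0 w))).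
  apply: (@bounded_integrable _ _ _ _ _ K) => [|w].
    by apply: measurable_funM => //; exact: measurableT_comp.
  by rewrite normrM -[leRHS]mul1r ler_pM// gK// -ler_norml.
have i2 : P.-integrable [set: T] (EFin \o (fun w => cX k w ^+ 2 * g' (cX i0 w))).
  apply: (@bounded_integrable _ _ _ _ _ K) => [|w].
    by apply: measurable_funM => //;
      [exact: measurable_funX|exact: measurableT_comp].
  rewrite normrM -[leRHS]mul1r ler_pM//; last by rewrite g'K// -ler_norml.
  by rewrite normrX expr_le1.
rewrite RintegralZl//; last first.
  rewrite (_ : _ \o _ = fun w => ((cX i0 w * g (cX i0 w))%:E -
    (cX k w ^+ 2 * g' (cX i0 w))%:E)%E); first exact: integrableB.
  by apply/funext => w; rewrite /= EFinB.
rewrite RintegralB// => /eqP; rewrite mulf_eq0 pnatr_eq0/= subr_eq0.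
by move/eqP.
Qed.

(** Summation of [stein_coord] over the [d - 1] indices [k != i0], whose squared coordinates add up
    to [1 - cX i0 w ^+ 2] on the sphere. It is integration by parts for the law of one coordinate,
    without its density. *)
Lemma stein : (d%:R - 1) * \int[P]_w (cX i0 w * g (cX i0 w)) =
  \int[P]_w ((1 - cX i0 w ^+ 2) * g' (cX i0 w)).
Proof.
have d0 : (0 < d)%N by case: d i0 => // -[].
have -> : d%:R - 1 = d.-1%:R :> R by rewrite -[in LHS](prednK d0) -natr1 addrK.
rewrite mulr_natl -[d in d.-1]card_ord -(cardC1 i0) -sumr_const.
transitivity (\sum_(k < d | k != i0) \int[P]_w (cX k w ^+ 2 * g' (cX i0 w))).
  by apply: eq_big => [k|k]; rewrite ?inE// => ki; exact: stein_coord.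
rewrite -Rintegral_sum => [|k _].
  apply: eq_Rintegral => w _; rewrite -mulr_suml; congr (_ * _).
  by rewrite -[in RHS](sX w) /nsq [in RHS](bigD1 i0)//= addrAC subrr add0r.
apply: (@bounded_integrable _ _ _ _ _ K) => [|w].
  by apply: measurable_funM => //;
    [exact: measurable_funX|exact: measurableT_comp].
have c1 i := sphere_coord_le1 i w.
rewrite normrM -[leRHS]mul1r ler_pM//; last by rewrite g'K// -ler_norml.
by rewrite normrX expr_le1.
Qed.

End Stein.

Section Moments.
Context {disp} {T : measurableType disp} {R : realType} {d : nat}.
Variables (P : probability T R) (X : T -> borel_vec R d) (i0 : 'I_d).
Hypotheses (uX : uniform_on_sphere P X) (sX : forall w, nsq (X w) = 1).
Variables (e b : R).
Hypothesis e0 : 0 < e.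

Let t w : R := (X w : 'rV[R]_d) ord0 i0.
(** At [x = t w] this is [e + |a X + b e_i0|^2], where [e_i0] is the coordinate vector; it is
    symmetric in [a] and [b]. *)
Let u (a : R) (x : R) := e + b ^+ 2 + a ^+ 2 + 2 * a * b * x.

Let mt : measurable_fun [set: T] t.
Proof. by case: uX => mX _ _; exact: (coord_measurable_vec mX). Qed.

Let t1 w : -1 <= t w <= 1.
Proof. by rewrite -ler_norml; exact: sphere_coord_le1. Qed.

Let u_ge a x : -1 <= x <= 1 -> e <= u a x.
Proof.
move=> x1; rewrite /u.
have : 0 <= (a + b * x) ^+ 2 + b ^+ 2 * (1 - x ^+ 2).
  apply: addr_ge0; first exact: sqr_ge0.
  apply: mulr_ge0; first exact: sqr_ge0.
  rewrite subr_ge0 -real_normK ?num_real//.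
  by rewrite expr_le1// ler_norml.
by rewrite !expr2 => ?; lra.
Qed.

Let u_gt0 a x : -1 <= x <= 1 -> 0 < u a x.
Proof. by move=> /(u_ge a); exact: lt_le_trans. Qed.

(** Differentiating a power of [u] in [a] produces the factor [2 * a + 2 * b * t w]; the powers of
    [t w] make the family closed under differentiation. *)
Definition moment (s : R) (k : nat) (a : R) : R :=
  \int[P]_w (t w ^+ k * (u a (t w)) `^ s).

(** The power is monotone in a direction that depends on the sign of [s]; adding the two endpoint
    values gives one bound for both. *)
Let powR_bound (x y s : R) : e <= x -> x <= y -> x `^ s <= e `^ s + y `^ s.
Proof.
move=> ex xy; have x0 := lt_le_trans e0 ex; have y0 := lt_le_trans x0 xy.
have [s0|s0] := leP 0 s.
  apply: (@le_trans _ _ (y `^ s)); last by rewrite lerDr powR_ge0.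
  by apply: ge0_ler_powR => //; rewrite ?nnegrE ltW.
apply: (@le_trans _ _ (e `^ s)); last by rewrite lerDl powR_ge0.
have [r r0 ->] : exists2 r, 0 < r & s = - r.
  by exists (- s); rewrite ?oppr_gt0 ?opprK.
rewrite !powRN lef_pV2 ?posrE ?powR_gt0//.
by apply: ge0_ler_powR => //; rewrite ?nnegrE ltW.
Qed.

Let u_le (A a x : R) : `|a| <= A -> -1 <= x <= 1 -> u a x <= e + (A + `|b|) ^+ 2.
Proof.
move=> aA x1; rewrite /u -!addrA lerD2l.
rewrite (_ : _ + _ = a ^+ 2 + b ^+ 2 + 2 * (a * b * x)); last by ring.
rewrite (_ : (A + _) ^+ 2 = A ^+ 2 + `|b| ^+ 2 + 2 * (A * `|b|)); last by ring.
rewrite real_normK ?num_real//; apply: lerD.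
  by rewrite lerD2r -real_normK ?num_real// ler_sqr// nnegrE// (le_trans _ aA).
rewrite ler_pM2l//; apply: (le_trans (ler_norm _)); rewrite !normrM.
rewrite -[leRHS]mulr1; apply: ler_pM => //; rewrite ?mulr_ge0//.
  exact: ler_pM.
by rewrite ler_norml.
Qed.

Let mu_pow s k a : measurable_fun [set: T] (fun w => t w ^+ k * (u a (t w)) `^ s).
Proof.
apply: measurable_funM; first exact: measurable_funX.
apply: (measurableT_comp (measurable_powR s)).
by apply: measurable_funD => //; exact: measurable_funM.
Qed.

Let pow_bound s k (A a : R) w : `|a| <= A ->
  `|t w ^+ k * (u a (t w)) `^ s| <= e `^ s + (e + (A + `|b|) ^+ 2) `^ s.
Proof.
move=> aA; rewrite normrM -[leRHS]mul1r ler_pM//.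
  by rewrite normrX exprn_ile1// ler_norml.
rewrite ger0_norm ?powR_ge0//; apply: powR_bound; first exact: u_ge.
exact: u_le.
Qed.

Let int_pow s k a :
  P.-integrable [set: T] (EFin \o (fun w => t w ^+ k * (u a (t w)) `^ s)).
Proof. by apply: bounded_integrable => // w; exact: pow_bound. Qed.

Let int_powZ c s k a :
  P.-integrable [set: T] (EFin \o (fun w => c * (t w ^+ k * (u a (t w)) `^ s))).
Proof.
rewrite (_ : _ \o _ = fun w => (c%:E * (t w ^+ k * (u a (t w)) `^ s)%:E)%E).
  apply: integrableZl => //. exact: int_pow.
by apply/funext => w; rewrite /= EFinM.
Qed.

Lemma moment_ge0 s a : 0 <= moment s 0 a.
Proof. by apply: Rintegral_ge0 => w _; rewrite expr0 mul1r powR_ge0. Qed.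

Lemma moment_succ s k a :
  moment (s + 1) k a = (e + b ^+ 2 + a ^+ 2) * moment s k a
    + 2 * a * b * moment s k.+1 a.
Proof.
rewrite /moment -!RintegralZl// -RintegralD//.
apply: eq_Rintegral => w _; rewrite powRD; last first.
  by rewrite (gt_eqF (u_gt0 a (t1 w))) implybT.
rewrite powRr1 ?(ltW (u_gt0 a (t1 w)))//; set v := _ `^ s.
by rewrite [t w ^+ k.+1]exprS /u; ring.
Qed.

Lemma is_derive_moment (s : R) k (a : R) : is_derive a 1 (moment s k)
  (s * (2 * a * moment (s - 1) k a + 2 * b * moment (s - 1) k.+1 a)).
Proof.
have E : s * (2 * a * moment (s - 1) k a + 2 * b * moment (s - 1) k.+1 a) =
  \int[P]_w (t w ^+ k * ((s * u a (t w) `^ (s - 1)) * (2 * a + 2 * b * t w))).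
  rewrite mulrDr !mulrA /moment -!RintegralZl// -RintegralD//.
  by apply: eq_Rintegral => w _; rewrite exprS; ring.
rewrite E.
(* [K] and [K'] bound the integrand and its derivative at all parameters [x] with
   [|x| <= |a| + 1]. *)
pose K := e `^ s + (e + (`|a| + 1 + `|b|) ^+ 2) `^ s.
pose K' := (e `^ (s - 1) + (e + (`|a| + 1 + `|b|) ^+ 2) `^ (s - 1))
  * (`|s| * (2 * (`|a| + 1) + 2 * `|b|)).
have xA (x : R) : a - 1 < x < a + 1 -> `|x| <= `|a| + 1.
  move=> xa; have := ler_norm a; have := ler_norm (- a); rewrite normrN.
  by rewrite ler_norml => *; lra.
have KK : K <= Num.max K K' /\ K' <= Num.max K K'.
  by rewrite !le_max !lexx orbT.
apply: (@is_derive_Rintegral _ _ _ P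
  (fun a w => t w ^+ k * (u a (t w)) `^ s)
  (fun a w => t w ^+ k * ((s * u a (t w) `^ (s - 1)) * (2 * a + 2 * b * t w)))
  (Num.max K K')).
- by move=> x _; exact: mu_pow.
- by move=> x w /xA xa; apply: le_trans KK.1; exact: pow_bound.
- move=> x w _; apply: is_derive_scale.
  apply: (@is_derive_compose _ (fun y => y `^ s) (fun x => u x (t w))).
    by apply: is_derive1_powR; exact: u_gt0.
  have D := is_derive_add (is_derive_add (is_derive_const (e + b ^+ 2) x)
    (is_derive_pow 2 x)) (is_derive_mul (is_derive_mul (is_derive_scale 2
      (is_derive_id x (1 : R))) (is_derive_const b x)) (is_derive_const (t w) x)).
  by apply: is_derive_eq D _; rewrite /= expr1; ring.
- move=> x w /xA xa; apply: le_trans KK.2.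
  rewrite (_ : _ * _ = (t w ^+ k * u x (t w) `^ (s - 1)) *
    (s * (2 * x + 2 * b * t w))); last by ring.
  rewrite normrM ler_pM// ?pow_bound// normrM ler_wpM2l//.
  apply: (le_trans (ler_normD _ _)); rewrite !normrM !normr_nat -!mulrA.
  apply: lerD; rewrite ler_pM2l// ler_piMr//.
  by rewrite ler_norml.
Qed.

(** Stein's identity for [g = u a] to the power [s]. In [darboux] it eliminates the first moment
    that the term [(d - 1) M1] brings in. *)
Lemma moment_stein s a : (d%:R - 1) * moment s 1 a =
  2 * a * b * s * (moment (s - 1) 0 a - moment (s - 1) 2 a).
Proof.
pose K := (e `^ s + (e + (`|a| + `|b|) ^+ 2) `^ s)
  + `|2 * a * b * s| * (e `^ (s - 1) + (e + (`|a| + `|b|) ^+ 2) `^ (s - 1)).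
pose g x := (u a x) `^ s.
pose g' x := 2 * a * b * s * (u a x) `^ (s - 1).
have mu x : measurable_fun [set: R] (fun y => u a y `^ x).
  apply: (measurableT_comp (measurable_powR x)).
  by apply: measurable_funD => //; exact: measurable_funM.
have pb x r : -1 <= x <= 1 ->
    `|u a x `^ r| <= e `^ r + (e + (`|a| + `|b|) ^+ 2) `^ r.
  move=> x1; rewrite ger0_norm ?powR_ge0//.
  by apply: powR_bound; [exact: u_ge|exact: u_le].
have st : (d%:R - 1) * \int[P]_w (t w * g (t w)) =
    \int[P]_w ((1 - t w ^+ 2) * g' (t w)).
  apply: (@stein _ _ _ _ P X i0 uX sX g g' K).
  - move=> x x1.
    have D := @is_derive_compose _ (fun y => y `^ s) (u a) x _ _
      (is_derive1_powR s (u_gt0 a x1))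
      (is_derive_add (is_derive_const (e + b ^+ 2 + a ^+ 2) x)
        (is_derive_scale (2 * a * b) (is_derive_id x (1 : R)))).
    by apply: is_derive_eq D _; rewrite /g'; ring.
  - move=> x x1; rewrite (le_trans (pb _ _ x1))// lerDl mulr_ge0//.
    by rewrite addr_ge0// powR_ge0.
  - move=> x x1; rewrite normrM.
    rewrite (le_trans (ler_wpM2l _ (pb _ _ x1)))// lerDr.
    by rewrite addr_ge0// powR_ge0.
  - exact: mu.
  - by apply: measurable_funM => //; exact: mu.
rewrite /moment (_ : \int[P]_w _ = \int[P]_w (t w * g (t w))); last first.
  by apply: eq_Rintegral => w _; rewrite expr1.
rewrite st -RintegralB//.
rewrite -RintegralZl//.
  by apply: eq_Rintegral => w _; rewrite /g' expr0 mul1r; ring.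
rewrite (_ : _ \o _ = fun w => ((t w ^+ 0 * (u a (t w)) `^ (s - 1))%:E -
  (t w ^+ 2 * (u a (t w)) `^ (s - 1))%:E)%E); last first.
  by apply/funext => w; rewrite /= EFinB.
apply: integrableB => //; exact: int_pow.
Qed.

End Moments.

Section MomentConvexity.
Context {disp} {T : measurableType disp} {R : realType} {d : nat}.
Variables (P : probability T R) (X : T -> borel_vec R d) (i0 : 'I_d).
Hypotheses (uX : uniform_on_sphere P X) (sX : forall w, nsq (X w) = 1).
Variables (e b : R).
Hypothesis e0 : 0 < e.

Local Notation M := (moment P X i0 e b).

Let M1 (s a : R) := s * (2 * a * M (s - 1) 0 a + 2 * b * M (s - 1) 1 a).

Let M2 (s a : R) := s * (2 * M (s - 1) 0 a
  + 2 * a * ((s - 1) * (2 * a * M (s - 1 - 1) 0 a + 2 * b * M (s - 1 - 1) 1 a))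
  + 2 * b * ((s - 1) * (2 * a * M (s - 1 - 1) 1 a + 2 * b * M (s - 1 - 1) 2 a))).

Let dM (s a : R) : is_derive a 1 (M s 0) (M1 s a).
Proof. exact: is_derive_moment. Qed.

Let dM1 (s a : R) : is_derive a 1 (M1 s) (M2 s a).
Proof.
have D := is_derive_scale s (is_derive_add
  (is_derive_mul (is_derive_scale 2 (is_derive_id a (1 : R)))
    (is_derive_moment i0 uX sX b e0 (s - 1) 0 a))
  (is_derive_scale (2 * b) (is_derive_moment i0 uX sX b e0 (s - 1) 1 a))).
by apply: is_derive_eq D _; rewrite /M2 mulr1.
Qed.

(** Writing [|x|^2 = (e + |x|^2) - e] leaves only powers of [e + |x|^2] in the Laplacian, so that
    the operation can be iterated. *)
Let lap (s a : R) :=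
  2 * s * (d%:R + 2 * s - 2) * M (s - 1) 0 a
  - 4 * e * s * (s - 1) * M (s - 1 - 1) 0 a.

(* The Laplacian of [(e + |x|^2)^s] averaged over the sphere of radius [a]
   centred at a point of norm [b]. *)
Let darboux (s a : R) : a * M2 s a + (d%:R - 1) * M1 s a = a * lap s a.
Proof.
have st := moment_stein i0 uX sX b e0 (s - 1) a.
have su := moment_succ i0 uX sX b e0 (s - 1 - 1) 0 a; rewrite subrK in su.
apply/eqP; rewrite -subr_eq0; apply/eqP.
(* The difference of the two sides is a combination of the defects of [st] and [su]. *)
transitivity (2 * b * s * ((d%:R - 1) * M (s - 1) 1 a
    - 2 * a * b * (s - 1) * (M (s - 1 - 1) 0 a - M (s - 1 - 1) 2 a))
  + 4 * a * s * (s - 1) * ((e + b ^+ 2 + a ^+ 2) * M (s - 1 - 1) 0 a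
    + 2 * a * b * M (s - 1 - 1) 1 a - M (s - 1) 0 a)).
  by rewrite /M1 /M2 /lap; ring.
by rewrite st su !subrr !mulr0 addr0.
Qed.

Variable p : R.
Hypotheses (p0 : p < 0) (dp : 4 <= d%:R + 2 * p).

(** [darboux] supplies the Laplacian of the average, and a second application its bilaplacian; the
    sign of the latter is what the threshold [4 <= d + 2p] secures. *)
Lemma moment_sqrt_convex (s x y : R) : 0 <= x -> x <= y -> y <= s ->
  M p 0 (Num.sqrt (s + x)) + M p 0 (Num.sqrt (s - x)) <=
  M p 0 (Num.sqrt (s + y)) + M p 0 (Num.sqrt (s - y)).
Proof.
have p0' := p0; have dp' := dp.
have [m dm] : exists m, d = m.+2.
  have d4 : (4 < d)%N by rewrite -(ltr_nat R); lra.
  by exists d.-2; case: d d4 => [|[]].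
apply: (@sqrt_comp_convex R (M p 0) (M1 p) (M2 p) (dM p) (dM1 p)).
pose c1 := 2 * p * (d%:R + 2 * p - 2); pose c2 := 4 * e * p * (p - 1).
(* The result of applying [lap] twice. The factor [2d + 4p - 8] is the sum of [d + 2p - 2] and
   [d + 2p - 6], collected from the two terms in [M (p - 3)]; every coefficient is nonnegative when
   [p < 0] and [d + 2p >= 4]. *)
pose L a := 4 * (p * (p - 1)) * (d%:R + 2 * p - 2) * (d%:R + 2 * p - 4)
    * M (p - 1 - 1) 0 a
  + 8 * e * (p * (p - 1)) * (2 - p) * (2 * d%:R + 4 * p - 8)
    * M (p - 1 - 1 - 1) 0 a
  + 16 * e ^+ 2 * (p * (p - 1)) * ((p - 2) * (p - 3))
    * M (p - 1 - 1 - 1 - 1) 0 a.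
have dm1 : d%:R - 1 = m.+1%:R :> R by rewrite dm -[in LHS]natr1 addrK.
apply: (@radial_bisubharmonic_convex R m (M1 p) (M2 p)
  (fun a => c1 * M (p - 1) 0 a - c2 * M (p - 1 - 1) 0 a)
  (fun a => c1 * M1 (p - 1) a - c2 * M1 (p - 1 - 1) a)
  (fun a => c1 * M2 (p - 1) a - c2 * M2 (p - 1 - 1) a) L (dM1 p)).
- by move=> a; apply: is_derive_sub; apply: is_derive_scale.
- by move=> a; apply: is_derive_sub; apply: is_derive_scale.
- by move=> a; rewrite -dm1 darboux.
- move=> a; rewrite -dm1.
  transitivity (c1 * (a * M2 (p - 1) a + (d%:R - 1) * M1 (p - 1) a)
    - c2 * (a * M2 (p - 1 - 1) a + (d%:R - 1) * M1 (p - 1 - 1) a)).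
    by ring.
  by rewrite !darboux /L /lap /c1 /c2; ring.
- move=> a _; have pp : 0 <= p * (p - 1) by nra.
  have p23 : 0 <= (p - 2) * (p - 3) by nra.
  have e0' := ltW e0.
  rewrite /L; move: (p * (p - 1)) ((p - 2) * (p - 3)) pp p23 => u v u0 v0.
  by rewrite !addr_ge0// !mulr_ge0// ?sqr_ge0 ?moment_ge0//; lra.
Qed.

End MomentConvexity.

(** * Decoupling independent vectors *)

Section Decoupling.
Context {d1 d2 : measure_display} {T : measurableType d1}
  {T2 : measurableType d2} {R : realType}.
Variables (P : probability T R) (G : set (set T)) (X : T -> T2).
Hypotheses (mG : G `<=` measurable) (GI : setI_closed G)
  (mX : measurable_fun [set: T] X)
  (GX : forall A B, G A -> measurable B ->
    P (A `&` X @^-1` B) = (P A * P (X @^-1` B))%E).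

Local Notation TG := (g_sigma_algebraType G).

Let mXB B : measurable B -> measurable (X @^-1` B).
Proof. by move=> mB; rewrite -[_ @^-1` _]setTI; exact: mX. Qed.

Let sub_measurable (A : set TG) : measurable A -> d1.-measurable (A : set T).
Proof. by apply: smallest_sub => //; exact: sigma_algebra_measurable. Qed.

(** For fixed [B], both sides are finite measures in [A] with the same total mass that agree on the
    pi-system [G], hence on the sigma-algebra it generates. *)
Let indep_sigma (A : set TG) B : measurable A -> measurable B ->
  P (A `&` X @^-1` B) = (P A * P (X @^-1` B))%E.
Proof.
move=> mA mB.
have PB : P (X @^-1` B) = ((fine (P (X @^-1` B)))%:E)%E.
  by rewrite fineK// fin_num_measure//; exact: mXB.
have r0 : 0 <= fine (P (X @^-1` B)) by rewrite fine_ge0.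
pose m1 := mrestr P (mXB mB).
pose m2 := mscale (NngNum r0) P.
have GT : [set Y | G Y /\ Y `<=` setT] = G.
  by apply/seteqP; split=> Y /=; [case|split].
rewrite [RHS]muleC PB.
apply: (@g_sigma_algebra_measure_unique_trace d1 R T G setT measurableT _ _
   m1 m2); rewrite ?GT//.
- change (P (setT `&` X @^-1` B) = (fine (P (X @^-1` B)))%:E * P setT)%E.
  by rewrite setTI PB probability_setT mule1.
- move=> Y GY.
  change (P (Y `&` X @^-1` B) = (fine (P (X @^-1` B)))%:E * P Y)%E.
  by rewrite GX// -PB muleC.
- change (P (setT `&` X @^-1` B) < +oo)%E.
  by rewrite setTI (le_lt_trans (probability_le1 _ _)) ?ltry//; exact: mXB.
Qed.

(** By [indep_sigma] the joint law of the identity map into [TG] and of [X] is a product measure,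
    and Tonelli applies. Keeping the sample point itself as first component covers every quantity
    measurable for [G] at once. *)
Lemma ge0_integral_decoupling (h : TG * T2 -> \bar R) :
  measurable_fun [set: TG * T2] h -> (forall z, 0 <= h z)%E ->
  (\int[P]_w h (w, X w) = \int[P]_w \int[P]_w' h (w, X w'))%E.
Proof.
move=> mh h0.
have mid : measurable_fun [set: T] (fun w => w : TG).
  by move=> _ A mA; rewrite setTI; exact: sub_measurable.
have mpair : measurable_fun [set: T] (fun w => ((w : TG), X w)).
  exact: measurable_fun_pair.
pose idT : {mfun T >-> TG} := mfun_Sub (mem_set mid).
pose XT : {mfun T >-> T2} := mfun_Sub (mem_set mX).
pose pT : {mfun T >-> (TG * T2)%type} := mfun_Sub (mem_set mpair).
transitivity (\int[distribution P pT]_z h z)%E.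
  by rewrite ge0_integral_pushforward.
transitivity (\int[distribution P idT \x distribution P XT]_z h z)%E.
  apply: eq_measure_integral => A mA _.
  exact/esym/product_measure_unique.
rewrite fubini_tonelli1// ge0_integral_pushforward//; last first.
- by move=> x _; apply: integral_ge0.
- exact: measurable_fun_fubini_tonelli_F.
apply: eq_integral => w _; rewrite /= /fubini_F ge0_integral_pushforward//.
by apply: (measurableT_comp mh); exact: measurable_fun_pair.
Qed.

End Decoupling.

Section Independence.
Context {disp : measure_display} {T : measurableType disp} {R : realType}
  {d : nat}.
Variables (P : probability T R) (xi : nat -> T -> borel_vec R d).
Hypotheses (mxi : forall k, measurable_fun [set: T] (xi k))
  (hindep : mutually_independent P xi).

(** A pi-system generating the sigma-algebra of all the vectors other than [xi i]; the empty [J]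
    contributes the whole space. *)
Definition cylinders_off (i : nat) : set (set T) :=
  [set A | exists (J : {fset nat}) (B : nat -> set (borel_vec R d)),
    [/\ i \notin J, forall j, j \in J -> measurable (B j) &
      A = \bigcap_(j in [set` J]) (xi j @^-1` B j)]].

Let mxiB k B : measurable B -> measurable (xi k @^-1` B).
Proof. by move=> mB; rewrite -[_ @^-1` _]setTI; exact: mxi. Qed.

Lemma cylinders_off_measurable i : cylinders_off i `<=` measurable.
Proof.
move=> _ [J [B [_ mB ->]]]; apply: fin_bigcap_measurable => [|j jJ].
  exact: finite_fset.
by apply: mxiB; exact: mB.
Qed.

Lemma cylinders_offI i : setI_closed (cylinders_off i).
Proof.
move=> _ _ [J1 [B1 [iJ1 mB1 ->]]] [J2 [B2 [iJ2 mB2 ->]]].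
exists (J1 `|` J2)%fset, (fun j => (if j \in J1 then B1 j else setT) `&`
  (if j \in J2 then B2 j else setT)); split.
- by rewrite inE negb_or iJ1.
- move=> j _; apply: measurableI.
    by case: ifPn => // /mB1.
  by case: ifPn => // /mB2.
- apply/seteqP; split=> w /=.
    move=> [h1 h2] j /=; rewrite inE => _; split.
      by case: ifPn => // j1; exact: h1.
    by case: ifPn => // j2; exact: h2.
  move=> h; split=> j /= jJ.
    by have /= := h j; rewrite inE jJ => /(_ isT)[].
  by have /= := h j; rewrite inE jJ orbT => /(_ isT)[].
Qed.

Lemma cylinders_off_indep i A B : cylinders_off i A -> measurable B ->
  P (A `&` xi i @^-1` B) = (P A * P (xi i @^-1` B))%E.
Proof.
move=> [J [C [iJ mC ->]]] mB.
pose C' j := if j == i then B else C j.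
have C'J j : j \in J -> C' j = C j.
  by rewrite /C'; case: eqP => // ->; rewrite (negbTE iJ).
have C'i : C' i = B by rewrite /C' eqxx.
have -> : \bigcap_(j in [set` J]) (xi j @^-1` C j) `&` xi i @^-1` B =
    \bigcap_(j in [set` (i |` J)%fset]) (xi j @^-1` C' j).
  apply/seteqP; split=> w /=.
    move=> [h hi] j /=; rewrite !inE => /predU1P[->|jJ]; first by rewrite C'i.
    by rewrite C'J//; exact: h.
  move=> h; split.
    by move=> j /= jJ; rewrite -C'J//; apply: h; rewrite /= !inE jJ orbT.
  by rewrite -C'i; apply: h; rewrite /= !inE eqxx.
rewrite !hindep//; last first.
  move=> j; rewrite !inE /C'; case: eqP => //= _; exact: mC.
rewrite big_fsetU1//= C'i muleC; congr (_ * _)%E.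
by apply: eq_big_seq => j jJ; rewrite C'J.
Qed.

Lemma measurable_cylinders_off i j : j != i ->
  measurable_fun [set: g_sigma_algebraType (cylinders_off i)] (xi j).
Proof.
move=> ji _ B mB; rewrite setTI; apply: sub_sigma_algebra.
exists [fset j]%fset, (fun=> B); split => //.
  by rewrite inE eq_sym.
by rewrite set_fset1 bigcap_set1.
Qed.

Lemma ge0_integral_independent i
    (h : g_sigma_algebraType (cylinders_off i) * borel_vec R d -> \bar R) :
  measurable_fun [set: g_sigma_algebraType (cylinders_off i) * borel_vec R d] h ->
  (forall z, 0 <= h z)%E ->
  (\int[P]_w h (w, xi i w) = \int[P]_w \int[P]_w' h (w, xi i w'))%E.
Proof.
apply: ge0_integral_decoupling => //.
- exact: cylinders_off_measurable.
- exact: cylinders_offI.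
- by move=> A B; exact: cylinders_off_indep.
Qed.

End Independence.

(** * Two random summands *)

Section Regularization.
Context {R : realType} {d : nat}.
Variables (e p : R).

Definition regpow (x : 'rV[R]_d) : \bar R := ((e + nsq x) `^ p)%:E.

Lemma regpow_ge0 x : (0 <= regpow x)%E.
Proof. by rewrite lee_fin powR_ge0. Qed.

Lemma regpow_mulO (O : 'M[R]_d) x : O *m O^T = 1%:M -> regpow (x *m O) = regpow x.
Proof. by move=> OO; rewrite /regpow nsq_mulO. Qed.

Lemma measurable_regpow {disp} {S : measurableType disp} (Y : S -> 'rV[R]_d) :
  coord_measurable Y -> measurable_fun [set: S] (fun s => regpow (Y s)).
Proof.
move=> mY; apply/measurable_EFinP.
apply: (measurableT_comp (measurable_powR p)).
by apply: measurable_funD => //; exact: measurable_nsq.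
Qed.

End Regularization.

Lemma coord_measurable_id {R : realType} {d : nat} :
  coord_measurable (fun x : borel_vec R d => x : 'rV[R]_d).
Proof. by move=> i; exact: measurable_coord. Qed.

Lemma measurable_integral_fst {R : realType} {d1 d2} {S : measurableType d1}
    {T : measurableType d2} (P : probability T R) (f : S * T -> \bar R) :
  measurable_fun [set: S * T] f -> (forall z, 0 <= f z)%E ->
  measurable_fun [set: S] (fun s => \int[P]_w f (s, w))%E.
Proof. by move=> mf f0; exact: measurable_fun_fubini_tonelli_F. Qed.

Section SphereAverage.
Context {disp} {T : measurableType disp} {R : realType} {d : nat}.
Variables (P : probability T R) (X : T -> borel_vec R d) (i0 : 'I_d).
Hypotheses (uX : uniform_on_sphere P X) (sX : forall w, nsq (X w) = 1).
Variables (e p : R).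
Hypothesis e0 : 0 < e.

(** An orthogonal map turns [z] into the direction of coordinate [i0], after which the norm involves
    a single coordinate of [X]. As [moment] is symmetric in the two lengths, this average over a
    sphere of radius [b] centred at [z] is also one over a sphere of radius [|z|], hence convex in
    [|z|^2]. *)
Lemma integral_sphere_regpow (b : R) (z : 'rV[R]_d) : p < 0 ->
  (\int[P]_w regpow e p (b *: (X w : 'rV[R]_d) + z)
    = (moment P X i0 e b p 0 (enorm z))%:E)%E.
Proof.
move=> p0; have mX : measurable_fun setT X by case: uX.
pose y : 'rV[R]_d := enorm z *: delta_mx ord0 i0.
have nd : nsq (delta_mx ord0 i0 : 'rV[R]_d) = 1.
  rewrite /nsq (bigD1 i0)//= mxE !eqxx expr1n big1 ?addr0// => j ji.
  by rewrite mxE (negbTE ji) andbF expr0n.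
have dXe (x : 'rV[R]_d) : dot x (delta_mx ord0 i0) = x ord0 i0.
  rewrite /dot (bigD1 i0)//= mxE !eqxx mulr1 big1 ?addr0// => j ji.
  by rewrite mxE (negbTE ji) mulr0.
have [U UU yU] : exists2 O, O *m O^T = 1%:M & y *m O = z.
  by apply: ex_orthogonal; rewrite nsqZ nd mulr1 sqr_enorm.
transitivity (\int[P]_w regpow e p (b *: (X w : 'rV[R]_d) + y))%E.
  rewrite -(ge0_integral_uniform_mulO uX
    (h := fun x => regpow e p (b *: (x : 'rV[R]_d) + z)) UU).
  - apply: eq_integral => w _.
    by rewrite -yU scalemxAl -mulmxDl regpow_mulO.
  - apply: measurable_regpow; apply: coord_measurableD.
      by apply: coord_measurableZ; exact: coord_measurable_id.
    exact: coord_measurable_cst.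
  - by move=> x; exact: regpow_ge0.
have E w : e + nsq (b *: (X w : 'rV[R]_d) + y) =
    e + b ^+ 2 + enorm z ^+ 2 + 2 * enorm z * b * (X w : 'rV[R]_d) ord0 i0.
  by rewrite nsqD !nsqZ sX nd /y dotZr dotZl dXe; ring.
rewrite /moment /Rintegral fineK.
  by apply: eq_integral => w _; rewrite expr0 mul1r -E.
apply: integrable_fin_num => //.
apply: (@bounded_integrable _ _ _ _ _ (e `^ p)).
  apply/measurable_EFinP.
  rewrite (_ : _ \o _ = fun w => regpow e p (b *: (X w : 'rV[R]_d) + y)).
    apply: measurable_regpow; apply: coord_measurableD.
      by apply: coord_measurableZ; exact: coord_measurable_vec.
    exact: coord_measurable_cst.
  by apply/funext => w /=; rewrite expr0 mul1r -E.
move=> w; rewrite expr0 mul1r -E ger0_norm ?powR_ge0//.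
have [r r0 ->] : exists2 r, 0 < r & p = - r.
  by exists (- p); rewrite ?oppr_gt0 ?opprK.
have ex : e <= e + nsq (b *: (X w : 'rV[R]_d) + y) by rewrite lerDl nsq_ge0.
rewrite !powRN lef_pV2 ?posrE ?powR_gt0//; last exact: lt_le_trans ex.
by apply: ge0_ler_powR => //; rewrite ?nnegrE ltW// (lt_le_trans e0).
Qed.

End SphereAverage.

Section TwoPoint.
Context {disp} {T : measurableType disp} {R : realType} {d : nat}.
Variables (P : probability T R) (X1 X2 : T -> borel_vec R d).
Hypotheses (uX1 : uniform_on_sphere P X1) (sX1 : forall w, nsq (X1 w) = 1)
  (uX2 : uniform_on_sphere P X2) (sX2 : forall w, nsq (X2 w) = 1).
Variables (e p : R).
Hypotheses (e0 : 0 < e) (p0 : p < 0) (dp : 4 <= d%:R + 2 * p).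

Local Notation Phi := (regpow e p).
Local Notation vec x := (x : 'rV[R]_d).

Let mX1 : coord_measurable X1.
Proof. by case: uX1 => /coord_measurable_vec. Qed.

Let mX2 : coord_measurable X2.
Proof. by case: uX2 => /coord_measurable_vec. Qed.

(** The two separate sample points encode the independence of the two vectors. *)
Definition twopoint (a b : R) (v : 'rV[R]_d) : \bar R :=
  (\int[P]_w2 \int[P]_w1 Phi (v + b *: vec (X2 w2) + a *: vec (X1 w1)))%E.

Lemma measurable_twopoint {d'} {S : measurableType d'} (V : S -> 'rV[R]_d) a b :
  coord_measurable V -> measurable_fun [set: S] (fun s => twopoint a b (V s)).
Proof.
move=> mV.
apply: (measurable_integral_fst P
  (f := fun z => \int[P]_w1 Phi (V z.1 + b *: vec (X2 z.2) + a *: vec (X1 w1)))%E).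
  apply: (measurable_integral_fst P (S := (S * T)%type)
    (f := fun z => Phi (V z.1.1 + b *: vec (X2 z.1.2) + a *: vec (X1 z.2)))).
    apply: measurable_regpow; apply: coord_measurableD.
      apply: coord_measurableD.
        apply: (@coord_measurable_comp _ _ _ _ _ _ V (fst \o fst)) => //.
        exact: measurableT_comp.
      apply: coord_measurableZ.
      apply: (@coord_measurable_comp _ _ _ _ _ _ X2 (snd \o fst)) => //.
      exact: measurableT_comp.
    by apply: coord_measurableZ; exact: coord_measurable_comp.
  by move=> z; exact: regpow_ge0.
by move=> z; apply: integral_ge0 => w _; exact: regpow_ge0.
Qed.

Let twopoint_mulO (O : 'M[R]_d) a b v : O *m O^T = 1%:M ->
  twopoint a b (v *m O) = twopoint a b v.
Proof.
move=> OO.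
have m1 y : measurable_fun [set: borel_vec R d]
    (fun x => Phi (v *m O + b *: vec y + a *: vec x)).
  apply: measurable_regpow; apply: coord_measurableD.
    exact: coord_measurable_cst.
  by apply: coord_measurableZ; exact: coord_measurable_id.
have m2 : measurable_fun [set: borel_vec R d] (fun y =>
    \int[P]_w1 Phi (v *m O + b *: vec y + a *: vec (X1 w1)))%E.
  apply: (measurable_integral_fst P (f := fun z : borel_vec R d * T =>
      Phi (v *m O + b *: vec z.1 + a *: vec (X1 z.2)))) => [|z];
    last exact: regpow_ge0.
  apply: measurable_regpow; apply: coord_measurableD.
    apply: coord_measurableD; first exact: coord_measurable_cst.
    apply: coord_measurableZ.
    apply: (@coord_measurable_comp _ _ _ _ _ _
      (fun x : borel_vec R d => vec x) fst) => //.
    exact: coord_measurable_id.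
  by apply: coord_measurableZ; exact: coord_measurable_comp.
apply: (eq_trans (esym (ge0_integral_uniform_mulO uX2 OO m2 _))).
  by move=> y; apply: integral_ge0 => w _; exact: regpow_ge0.
apply: eq_integral => w2 _.
apply: (eq_trans (esym (ge0_integral_uniform_mulO uX1 OO (m1 _) _))).
  by move=> y; exact: regpow_ge0.
apply: eq_integral => w1 _.
by rewrite !scalemxAl -!mulmxDl regpow_mulO.
Qed.

Variable i0 : 'I_d.

Let psi (v : 'rV[R]_d) (r : R) : R := moment P X1 i0 e (enorm v) p 0 (Num.sqrt r).

Let avg v z : (\int[P]_w0 Phi (enorm v *: vec (X1 w0) + z) = (psi v (nsq z))%:E)%E.
Proof. by rewrite (integral_sphere_regpow i0 uX1 sX1 e0 _ _ p0). Qed.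

(* [twopoint a b] is radial, so its argument may be averaged over a sphere. *)
Let twopointE a b v : twopoint a b v =
  (\int[P]_w2 \int[P]_w1 (psi v (nsq (b *: vec (X2 w2) + a *: vec (X1 w1))))%:E)%E.
Proof.
have cst w0 : twopoint a b (enorm v *: vec (X1 w0)) = twopoint a b v.
  have [|U UU <-] := @ex_orthogonal R d v (enorm v *: vec (X1 w0)).
    by rewrite nsqZ sX1 mulr1 sqr_enorm.
  exact: twopoint_mulO.
transitivity (\int[P]_w0 twopoint a b (enorm v *: vec (X1 w0)))%E.
  under eq_integral do rewrite cst.
  rewrite integral_cst// (_ : _ setT = 1%E) ?mule1//; exact: probability_setT.
have m0 : coord_measurable (fun w0 => enorm v *: vec (X1 w0)).
  exact: coord_measurableZ.
pose F (z : (T * T) * T) := Phi (enorm v *: vec (X1 z.1.1)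
  + b *: vec (X2 z.1.2) + a *: vec (X1 z.2)).
have mF : measurable_fun setT F.
  apply: measurable_regpow; apply: coord_measurableD.
    apply: coord_measurableD; apply: coord_measurableZ.
      apply: (@coord_measurable_comp _ _ _ _ _ _ X1 (fst \o fst)) => //.
      exact: measurableT_comp.
    apply: (@coord_measurable_comp _ _ _ _ _ _ X2 (snd \o fst)) => //.
    exact: measurableT_comp.
  by apply: coord_measurableZ; exact: coord_measurable_comp.
rewrite /twopoint.
(* The variable [w0] is moved past [w2], then past [w1], to become innermost, where [avg]
   applies. *)
rewrite (fubini_tonelli (m1 := P) (m2 := P) (fun z => \int[P]_w1 F (z, w1))%E).
- apply: eq_integral => w2 _.
  rewrite (fubini_tonelli (m1 := P) (m2 := P) (fun z => F ((z.1, w2), z.2))).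
  + apply: eq_integral => w1 _; rewrite -avg; apply: eq_integral => w0 _.
    by rewrite /F/= addrA.
  + apply: (measurableT_comp mF); apply: measurable_fun_pair => //.
    exact: measurable_fun_pair.
  + by move=> z; exact: regpow_ge0.
- apply: (measurable_integral_fst P mF) => z; exact: regpow_ge0.
- by move=> z; apply: integral_ge0 => w _; exact: regpow_ge0.
Qed.

Let dot_le1 (x y : 'rV[R]_d) : nsq x = 1 -> nsq y = 1 -> `|dot x y| <= 1.
Proof.
move=> x1 y1; have := nsq_ge0 (x + y); have := nsq_ge0 (x - y).
rewrite !nsqD dotNr -scaleN1r nsqZ x1 y1 ler_norml expr2 => *.
by apply/andP; split; lra.
Qed.

(** The two squared norms are [s + t] and [s - t] with [t = 2ab <y, x>], so the claim is convexity
    at distances [|t| <= |t'|] from [s]; [|t'| <= s] because [2|a'b'| <= a'^2 + b'^2]. *)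
Let psi_sym_le a b a' b' v (x y : 'rV[R]_d) : a ^+ 2 + b ^+ 2 = a' ^+ 2 + b' ^+ 2 ->
  `|a * b| <= `|a' * b'| -> nsq x = 1 -> nsq y = 1 ->
  psi v (nsq (b *: y + a *: x)) + psi v (nsq (b *: y + a *: - x)) <=
  psi v (nsq (b' *: y + a' *: x)) + psi v (nsq (b' *: y + a' *: - x)).
Proof.
move=> ab ab' x1 y1.
have cvx (s r t : R) : 0 <= r -> r <= t -> t <= s ->
    psi v (s + r) + psi v (s - r) <= psi v (s + t) + psi v (s - t).
  exact: (moment_sqrt_convex i0 uX1 sX1 (enorm v) e0 p0 dp).
move: (psi v) cvx => f cvx.
pose s := a ^+ 2 + b ^+ 2; pose c := dot y x.
have E (g h : R) : nsq (g *: y + h *: x) = h ^+ 2 + g ^+ 2 + 2 * (h * g) * c.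
  by rewrite nsqD !nsqZ x1 y1 dotZl dotZr -/c; ring.
have E' (g h : R) : nsq (g *: y + h *: - x) = h ^+ 2 + g ^+ 2 - 2 * (h * g) * c.
  by rewrite scalerN -scaleNr E sqrrN; ring.
have sym (t : R) : f (s + t) + f (s - t) = f (s + `|t|) + f (s - `|t|).
  have [t0|t0] := leP 0 t; first by rewrite (ger0_norm t0).
  by rewrite (ltr0_norm t0) opprK [RHS]addrC.
rewrite (E b a) (E' b a) (E b' a') (E' b' a') -ab -[a ^+ 2 + b ^+ 2]/s.
rewrite (sym (2 * (a * b) * c)) (sym (2 * (a' * b') * c)).
have c1 : `|c| <= 1 by exact: dot_le1.
apply: cvx; first exact: normr_ge0.
  by rewrite !(normrM (2 * _)) !(normrM 2) ler_wpM2r// ler_pM2l// normr_nat.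
rewrite normrM (normrM 2) normr_nat (le_trans (ler_piMr _ c1))//.
rewrite /s ab normrM -(real_normK (num_real a')) -(real_normK (num_real b')).
by rewrite -subr_ge0 (_ : _ - _ = (`|a'| - `|b'|) ^+ 2) ?sqr_ge0//; ring.
Qed.

Lemma twopoint_le a b a' b' v : a ^+ 2 + b ^+ 2 = a' ^+ 2 + b' ^+ 2 ->
  `|a * b| <= `|a' * b'| -> (twopoint a b v <= twopoint a' b' v)%E.
Proof.
move=> ab ab'; rewrite !twopointE.
have psi0 r : (0 <= (psi v r)%:E)%E by rewrite lee_fin moment_ge0.
have mpsi d' (S : measurableType d') (Y : S -> 'rV[R]_d) : coord_measurable Y ->
    measurable_fun [set: S] (fun s => (psi v (nsq (Y s)))%:E).
  move=> mY; under eq_fun do rewrite -avg.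
  apply: (measurable_integral_fst P (f := fun z =>
    Phi (enorm v *: vec (X1 z.2) + Y z.1))) => [|z]; last exact: regpow_ge0.
  apply: measurable_regpow; apply: coord_measurableD.
    by apply: coord_measurableZ; exact: coord_measurable_comp.
  exact: coord_measurable_comp.
have sym_le x y := @psi_sym_le a b a' b' v x y ab ab'.
move: (psi v) psi0 mpsi sym_le => f f0 mf sym_le {ab ab'}.
have m2 (g h : R) : measurable_fun setT (fun w2 =>
    \int[P]_w1 (f (nsq (g *: vec (X2 w2) + h *: vec (X1 w1))))%:E)%E.
  apply: (measurable_integral_fst P (f := fun z =>
    (f (nsq (g *: vec (X2 z.1) + h *: vec (X1 z.2))))%:E)%E) => //.
  apply: mf; apply: coord_measurableD; apply: coord_measurableZ;
    exact: coord_measurable_comp.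
apply: ge0_le_integral => //; try by move=> w _; exact: integral_ge0.
move=> w2 _; set y := vec (X2 w2).
have m1 (g h : R) : measurable_fun setT (fun w1 =>
    (f (nsq (g *: y + h *: vec (X1 w1))))%:E).
  apply: mf; apply: coord_measurableD; first exact: coord_measurable_cst.
  exact: coord_measurableZ.
have m1' (g h : R) : measurable_fun setT (fun w1 =>
    (f (nsq (g *: y + h *: - vec (X1 w1))))%:E).
  apply: mf; apply: coord_measurableD; first exact: coord_measurable_cst.
  under eq_fun do rewrite scalerN -scaleNr.
  exact: coord_measurableZ.
(* [- X1] has the law of [X1], so twice the integral is the integral of the symmetric pair compared
   in [psi_sym_le]. *)
have dbl (g h : R) (I := (\int[P]_w1 (f (nsq (g *: y + h *: vec (X1 w1))))%:E)%E) :
    (I + I = \int[P]_w1 (f (nsq (g *: y + h *: vec (X1 w1)))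
      + f (nsq (g *: y + h *: - vec (X1 w1))))%:E)%E.
  under [RHS]eq_integral do rewrite EFinD.
  rewrite ge0_integralD//; congr (_ + _)%E; rewrite /I.
  have N1 : (- 1%:M : 'M[R]_d) *m (- 1%:M)^T = 1%:M.
    by rewrite linearN/= trmx1 mulmxN mulNmx opprK mulmx1.
  have mh : measurable_fun [set: borel_vec R d]
      (fun x => (f (nsq (g *: y + h *: vec x)))%:E).
    apply: mf; apply: coord_measurableD; first exact: coord_measurable_cst.
    by apply: coord_measurableZ; exact: coord_measurable_id.
  apply: (eq_trans (esym (ge0_integral_uniform_mulO uX1 N1 mh _))) => //.
  by apply: eq_integral => w1 _; rewrite mulmxN mulmx1.
(* Doubling a strict inequality avoids halving in the extended reals. *)
rewrite leNgt; apply/negP => lt.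
have := lteD lt lt; rewrite ltNge => /negP; apply; rewrite !dbl.
apply: ge0_le_integral => //.
- by move=> w _; rewrite lee_fin addr_ge0// -lee_fin.
- by under eq_fun do rewrite EFinD; exact: emeasurable_funD.
- by under eq_fun do rewrite EFinD; exact: emeasurable_funD.
- by move=> w1 _; rewrite lee_fin; exact: sym_le (sX1 w1) (sX2 w2).
Qed.

End TwoPoint.

(** * Equal coefficients are extremal *)

Section RobinHood.
Context {R : realType}.

(** If some square exceeds [mu^2], the fixed sum forces another below it: that one is set to [mu]
    and [x] absorbs the rest, which raises the squared product by [(a_i^2 - mu^2)(mu^2 - a_j^2)].
    The clause [a i = mu -> x = mu] prevents a correct coefficient from being spoiled. *)
Let robin_hood_step n (a : nat -> R) (mu : R) : 0 <= mu -> (1 < n)%N ->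
  \sum_(k < n) a k ^+ 2 = n%:R * mu ^+ 2 ->
  (exists k : 'I_n, a k != mu) ->
  exists (i j : 'I_n) (x : R), [/\ i != j, a j != mu, a i = mu -> x = mu,
    a i ^+ 2 + a j ^+ 2 = x ^+ 2 + mu ^+ 2 & `|a i * a j| <= `|x * mu|].
Proof.
move=> mu0 n1 sa [j0 aj0].
have s0 : \sum_(k < n) (a k ^+ 2 - mu ^+ 2) = 0.
  by rewrite sumrB sa sumr_const card_ord mulr_natl subrr.
have s0' : \sum_(k < n) (mu ^+ 2 - a k ^+ 2) = 0.
  by rewrite sumrB sa sumr_const card_ord mulr_natl subrr.
have [/existsP[i ai]|/existsPn noi] := boolP [exists i : 'I_n, mu ^+ 2 < a i ^+ 2].
  have [/existsP[j aj]|/existsPn noj] := boolP [exists j : 'I_n, a j ^+ 2 < mu ^+ 2].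
    have x0 : 0 <= a i ^+ 2 + a j ^+ 2 - mu ^+ 2.
      by have := sqr_ge0 (a j); lra.
    exists i, j, (Num.sqrt (a i ^+ 2 + a j ^+ 2 - mu ^+ 2)); split.
    - by apply: contraTneq ai => ->; rewrite -leNgt ltW.
    - by apply: contraTneq aj => ->; rewrite ltxx.
    - by move=> ai'; move: ai; rewrite ai' ltxx.
    - by rewrite sqr_sqrtr// subrK.
    - rewrite -ler_sqr ?nnegrE// !real_normK ?num_real// !exprMn sqr_sqrtr//.
      rewrite -subr_ge0 (_ : _ - _ =
        (a i ^+ 2 - mu ^+ 2) * (mu ^+ 2 - a j ^+ 2)); last by ring.
      by rewrite mulr_ge0// subr_ge0 ltW.
  have h (k : 'I_n) : true -> 0 <= a k ^+ 2 - mu ^+ 2.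
    by move=> _; rewrite subr_ge0 leNgt noj.
  have /subr0_eq E : a i ^+ 2 - mu ^+ 2 = 0 by exact: (psumr_eq0P h s0).
  by move: ai; rewrite E ltxx.
(* Only signs are left to correct: [a j0 = - mu] is flipped, any other index serving as unchanged
   partner. *)
have E (k : 'I_n) : a k ^+ 2 = mu ^+ 2.
  have h (l : 'I_n) : true -> 0 <= mu ^+ 2 - a l ^+ 2.
    by move=> _; rewrite subr_ge0 leNgt noi.
  have /subr0_eq-> // : mu ^+ 2 - a k ^+ 2 = 0 by exact: (psumr_eq0P h s0').
have [i ij0] : exists i : 'I_n, i != j0.
  have [j00|j00] := eqVneq (j0 : nat) 0%N.
    by exists (Ordinal n1); rewrite -val_eqE/= j00.
  by exists (Ordinal (ltnW n1)); rewrite -val_eqE/= eq_sym.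
exists i, j0, (a i); split => //; first by rewrite !E.
by rewrite -ler_sqr ?nnegrE// !real_normK ?num_real// !exprMn !E.
Qed.

(** Induction on the number of coefficients different from [mu], which each step lowers. *)
Lemma robin_hood n (F : (nat -> R) -> \bar R) (a : nat -> R) (mu : R) :
  (forall a a' : nat -> R, (forall k : 'I_n, a k = a' k) -> F a = F a') ->
  (forall (a a' : nat -> R) (i j : 'I_n), i != j ->
    (forall k : 'I_n, k != i -> k != j -> a' k = a k) ->
    a i ^+ 2 + a j ^+ 2 = a' i ^+ 2 + a' j ^+ 2 ->
    `|a i * a j| <= `|a' i * a' j| -> (F a <= F a')%E) ->
  0 <= mu -> (1 < n)%N -> \sum_(k < n) a k ^+ 2 = n%:R * mu ^+ 2 ->
  (F a <= F (fun=> mu))%E.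
Proof.
move=> eqF leF mu0 n1 sa.
have [N] := ubnP #|[pred k : 'I_n | a k != mu]|.
elim: N => // N IH in a sa *; rewrite ltnS => aN.
have [/existsP ex|/existsPn all] := boolP [exists k : 'I_n, a k != mu]; last first.
  by rewrite (eqF a (fun=> mu))// => k; apply/eqP; rewrite -[_ == _]negbK.
have [i [j [x [ij aj ai sq pr]]]] := robin_hood_step mu0 n1 sa ex.
have [a' [a'i a'j a'k]] : exists a' : nat -> R, [/\ a' i = x, a' j = mu &
    forall k : 'I_n, k != i -> k != j -> a' k = a k].
  exists (fun k : nat => if k == i then x else if k == j then mu else a k).
  split; rewrite ?eqxx//; first by rewrite ifN// eq_sym.
  by move=> k ki kj; rewrite !ifN.
apply: (@le_trans _ _ (F a')).
  by apply: (leF a a' i j ij) => //; rewrite ?a'i ?a'j.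
apply: IH.
  rewrite -sa (bigD1 i)//= (bigD1 j)/=; last by rewrite eq_sym.
  rewrite [RHS](bigD1 i)//= [in RHS](bigD1 j)/=; last by rewrite eq_sym.
  rewrite !addrA a'i a'j sq; congr (_ + _).
  by apply: eq_bigr => k /andP[ki kj]; rewrite a'k.
apply: leq_trans aN; apply: proper_card; apply/properP; split.
  apply/fintype.subsetP => k; rewrite !inE.
  have [->|ki] := eqVneq k i; first by rewrite a'i; apply: contra => /eqP/ai ->.
  have [->|kj] := eqVneq k j; first by rewrite a'j eqxx.
  by rewrite a'k.
by exists j; rewrite !inE ?aj// a'j eqxx.
Qed.

End RobinHood.

Section UniformExtremal.
Context {disp : measure_display} {T : measurableType disp} {R : realType}
  {d : nat}.
Variables (P : probability T R) (xi : nat -> T -> borel_vec R d).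
Hypotheses (hunif : forall k, uniform_on_sphere P (xi k))
  (hindep : mutually_independent P xi)
  (sxi : forall k w, nsq (xi k w) = 1).
Variables (e p : R).
Hypotheses (e0 : 0 < e) (p0 : p < 0) (dp : 4 <= d%:R + 2 * p).

Local Notation vec x := (x : 'rV[R]_d).

Let mxi k : measurable_fun [set: T] (xi k). Proof. by case: (hunif k). Qed.

Definition regmean (n : nat) (a : nat -> R) : \bar R :=
  (\int[P]_w regpow e p (lin_comb xi n a w))%E.

Let rest (n : nat) (a : nat -> R) (i j : 'I_n) w : 'rV[R]_d :=
  \sum_(k < n | (k != i) && (k != j)) a k *: vec (xi k w).

Let lin_combE n a (i j : 'I_n) w : i != j ->
  lin_comb xi n a w = rest a i j w + a j *: vec (xi j w) + a i *: vec (xi i w).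
Proof.
move=> ij; rewrite /lin_comb (bigD1 i)//= (bigD1 j)/=; last by rewrite eq_sym.
by rewrite addrC [X in X + _]addrC.
Qed.

Let coord_measurable_off i k : k != i -> coord_measurable
  (fun w : g_sigma_algebraType (cylinders_off xi i) => vec (xi k w)).
Proof. move=> ki; apply: coord_measurable_vec; exact: measurable_cylinders_off. Qed.

(** [xi i] is decoupled from all the others, then [xi j]; the second time [xi i] lives on its own
    sample point, so only [rest] has to be measurable off [j]. *)
Let regmeanE n a (i j : 'I_n) : i != j -> regmean n a =
  (\int[P]_w twopoint P (xi i) (xi j) e p (a i) (a j) (rest a i j w))%E.
Proof.
move=> ij; have nij : i != j :> nat by [].
have nji : j != i :> nat by rewrite eq_sym.
transitivity (\int[P]_w \int[P]_w1 regpow e p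
    (rest a i j w + a j *: vec (xi j w) + a i *: vec (xi i w1)))%E.
  pose h (z : g_sigma_algebraType (cylinders_off xi i) * borel_vec R d) :=
    regpow e p (rest a i j z.1 + a j *: vec (xi j z.1) + a i *: vec z.2).
  have mh : measurable_fun setT h.
    apply: measurable_regpow; apply: coord_measurableD.
      pose V (w : g_sigma_algebraType (cylinders_off xi i)) :=
        rest a i j w + a j *: vec (xi j w).
      apply: (@coord_measurable_comp _ _ _ _ _ _ V fst) => //.
      apply: coord_measurableD; last first.
        by apply: coord_measurableZ; exact: coord_measurable_off.
      apply: coord_measurable_sum => k /andP[ki _].
      by apply: coord_measurableZ; exact: coord_measurable_off.
    apply: coord_measurableZ.
    apply: (@coord_measurable_comp _ _ _ _ _ _
      (fun x : borel_vec R d => vec x) snd) => //.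
    exact: coord_measurable_id.
  rewrite -(ge0_integral_independent mxi hindep mh); last first.
    by move=> z; exact: regpow_ge0.
  by apply: eq_integral => w _; rewrite (lin_combE _ _ ij).
pose h (z : g_sigma_algebraType (cylinders_off xi j) * borel_vec R d) :=
  (\int[P]_w1 regpow e p
    (rest a i j z.1 + a j *: vec z.2 + a i *: vec (xi i w1)))%E.
have mh : measurable_fun setT h.
  apply: (measurable_integral_fst P (f := fun z :
      (g_sigma_algebraType (cylinders_off xi j) * borel_vec R d) * T =>
    regpow e p (rest a i j z.1.1 + a j *: vec z.1.2 + a i *: vec (xi i z.2))));
    last by move=> z; exact: regpow_ge0.
  apply: measurable_regpow; apply: coord_measurableD; last first.
    apply: coord_measurableZ.
    apply: (@coord_measurable_comp _ _ _ _ _ _ (xi i) snd) => //.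
    exact: coord_measurable_vec.
  apply: coord_measurableD.
    apply: (@coord_measurable_comp _ _ _ _ _ _
      (fun w : g_sigma_algebraType (cylinders_off xi j) => rest a i j w)
      (fst \o fst)); first exact: measurableT_comp.
    apply: coord_measurable_sum => k /andP[_ kj].
    by apply: coord_measurableZ; exact: coord_measurable_off.
  apply: coord_measurableZ.
  apply: (@coord_measurable_comp _ _ _ _ _ _ (fun x : borel_vec R d => vec x)
    (snd \o fst)); first exact: measurableT_comp.
  exact: coord_measurable_id.
apply: (ge0_integral_independent mxi hindep mh).
by move=> z; apply: integral_ge0 => w _; exact: regpow_ge0.
Qed.

Let regmean_transfer n (a a' : nat -> R) (i j : 'I_n) : i != j ->
  (forall k : 'I_n, k != i -> k != j -> a' k = a k) ->
  a i ^+ 2 + a j ^+ 2 = a' i ^+ 2 + a' j ^+ 2 ->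
  `|a i * a j| <= `|a' i * a' j| -> (regmean n a <= regmean n a')%E.
Proof.
move=> ij aa' sq pr; rewrite !(regmeanE _ ij).
have i0 : 'I_d.
  have d0 : (0 < d)%N.
    by have p0' := p0; have dp' := dp; rewrite -(ltr_nat R); lra.
  exact: Ordinal d0.
have -> : rest a' i j = rest a i j.
  by apply/funext => w; apply: eq_bigr => k /andP[ki kj]; rewrite aa'.
have mrest : coord_measurable (rest a i j).
  apply: coord_measurable_sum => k _; apply: coord_measurableZ.
  exact: coord_measurable_vec.
apply: ge0_le_integral; first exact: measurableT.
- move=> w _; apply: integral_ge0 => w2 _; apply: integral_ge0 => w1 _.
  exact: regpow_ge0.
- by apply: measurable_twopoint => //; exact: hunif.
- by apply: measurable_twopoint => //; exact: hunif.
- move=> w _; apply: (twopoint_le (hunif i) (sxi i) (hunif j) (sxi j) e0 p0 dp i0).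
    exact: sq.
  exact: pr.
Qed.

Let eq_regmean n (a a' : nat -> R) : (forall k : 'I_n, a k = a' k) ->
  regmean n a = regmean n a'.
Proof.
move=> aa'; apply: eq_integral => w _; congr regpow.
by apply: eq_bigr => k _; rewrite aa'.
Qed.

Lemma regmean_le_uniform n (a : nat -> R) (mu : R) : 0 <= mu -> (0 < n)%N ->
  \sum_(k < n) a k ^+ 2 = n%:R * mu ^+ 2 ->
  (regmean n a <= regmean n (fun=> mu))%E.
Proof.
move=> mu0; rewrite leq_eqVlt => /predU1P[<-|n1] sa.
  (* A single summand has no partner for a transfer, but its norm depends only on the square of its
     coefficient. *)
  rewrite le_eqVlt; apply/orP; left; apply/eqP/eq_integral => w _.
  rewrite /regpow /lin_comb !big_ord1 !nsqZ.
  by move: sa; rewrite big_ord1 mul1r => ->.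
exact: (robin_hood (@eq_regmean n) (@regmean_transfer n)).
Qed.

End UniformExtremal.

(** * Negative powers of the norm *)

Section Epow.
Context {R : realType}.
Implicit Types (x y : \bar R) (r q : R).

Lemma epow_ge0 x r : (0 <= epow x r)%E.
Proof. by rewrite /epow; case: ifPn => _; rewrite ?inve_ge0 poweR_ge0. Qed.

Lemma epow_le_lt0 x y r : r < 0 -> (0 <= x)%E -> (x <= y)%E ->
  (epow y r <= epow x r)%E.
Proof.
move=> r0 x0 xy; rewrite /epow r0 lee_pV2 ?inE ?poweR_ge0//.
have y0 := le_trans x0 xy.
by apply: gt0_ler_poweR; rewrite ?in_itv/= ?leey ?andbT ?oppr_ge0// ltW.
Qed.

Lemma epow_EFin r q : q < 0 -> 0 <= r ->
  epow r%:E q = if r == 0 then +oo%E else (r `^ q)%:E.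
Proof.
move=> q0 r0; rewrite /epow q0 poweR_EFin; have [->|rN0] := eqVneq r 0.
  by rewrite powR0 ?inve0// oppr_eq0 lt_eqF.
have rp : 0 < r by rewrite lt_neqAle eq_sym rN0.
by rewrite inver gt_eqF ?powR_gt0// powRN invrK.
Qed.

End Epow.

Section EpowNorm.
Context {R : realType} {d : nat}.
Variable q : R.
Hypothesis q0 : q < 0.
Implicit Type x : 'rV[R]_d.

Let q2 : q / 2 < 0. Proof. by rewrite pmulr_llt0 ?invr_gt0. Qed.

Lemma epow_enorm x : epow (enorm x)%:E q =
  if nsq x == 0 then +oo%E else (nsq x `^ (q / 2))%:E.
Proof.
rewrite epow_EFin ?sqrtr_ge0// enormE sqrtr_eq0.
rewrite (_ : (nsq x <= 0) = (nsq x == 0)); last first.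
  by rewrite eq_le nsq_ge0 andbT.
case: ifPn => // _; rewrite -powR12_sqrt ?nsq_ge0// -powRrM.
by rewrite [2^-1 * _]mulrC.
Qed.

Lemma regpow_le e e' x : 0 < e -> e <= e' ->
  (regpow e' (q / 2) x <= regpow e (q / 2) x)%E.
Proof.
move=> e0 ee; rewrite lee_fin.
have [r r0 ->] : exists2 r, 0 < r & q / 2 = - r.
  by exists (- (q / 2)); rewrite ?oppr_gt0 ?opprK.
have x0 := nsq_ge0 x.
have ex : 0 < e + nsq x by rewrite (lt_le_trans e0)// lerDl.
have ex' : 0 < e' + nsq x by rewrite (lt_le_trans ex)// lerD2r.
rewrite !powRN lef_pV2 ?posrE ?powR_gt0//.
by apply: ge0_ler_powR; rewrite ?nnegrE ?lerD2r// ltW.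
Qed.

Lemma regpow_le_epow e x : 0 < e -> (regpow e (q / 2) x <= epow (enorm x)%:E q)%E.
Proof.
move=> e0; rewrite epow_enorm; case: ifPn => [_|xN0]; first exact: leey.
have x0 : 0 < nsq x by rewrite lt_neqAle eq_sym xN0 nsq_ge0.
rewrite lee_fin.
have [r r0 ->] : exists2 r, 0 < r & q / 2 = - r.
  by exists (- (q / 2)); rewrite ?oppr_gt0 ?opprK.
have ex : 0 < e + nsq x by rewrite addr_gt0.
rewrite !powRN lef_pV2 ?posrE ?powR_gt0//.
by apply: ge0_ler_powR; rewrite ?nnegrE ?lerDr// ltW.
Qed.

Lemma regpow_cvg x :
  (regpow m.+1%:R^-1 (q / 2) x @[m --> \oo] --> epow (enorm x)%:E q)%E.
Proof.
rewrite epow_enorm; case: ifPn => [/eqP xE|xN0].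
  apply/cvgeyPge => A; rewrite /regpow xE.
  have [r r0 ->] : exists2 r, 0 < r & q / 2 = - r.
    by exists (- (q / 2)); rewrite ?oppr_gt0 ?opprK.
  near=> m.
  rewrite addr0 lee_fin powRN -[m.+1%:R^-1]powR_inv1// -powRrM -powRN mulN1r opprK.
  apply: (le_trans (ler_norm A)).
  (* At a zero of the norm the value is [m.+1] to the power [r], which passes [|A|] once [m] exceeds
     [|A|] to the power [1/r]. *)
  rewrite -[leLHS]powRr1// -[X in _ `^ X](mulVf (lt0r_neq0 r0)) powRrM.
  apply: ge0_ler_powR; rewrite ?nnegrE ?powR_ge0 ?(ltW r0)//.
  apply: (@le_trans _ _ m%:R); last by rewrite ler_nat.
  by near: m; exact: nbhs_infty_ger.
have x0 : 0 < nsq x by rewrite lt_neqAle eq_sym xN0 nsq_ge0.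
apply/cvg_EFin; first exact: nearW.
apply: (@continuous_cvg _ _ _ _ _ _ (fun y => y `^ (q / 2))).
  exact: is_derive_continuous (is_derive1_powR _ x0).
rewrite -[X in _ --> X]add0r; apply: cvgD; last exact: cvg_cst.
exact: cvg_harmonic.
Unshelve. all: by end_near. Qed.

End EpowNorm.

(** * Second moments and homogeneity of the norms *)

Section SecondMoment.
Context {disp : measure_display} {T : measurableType disp} {R : realType}
  {d : nat}.
Variables (P : probability T R) (xi : nat -> T -> borel_vec R d).
Hypotheses (hunif : forall k, uniform_on_sphere P (xi k))
  (hindep : mutually_independent P xi)
  (sxi : forall k w, nsq (xi k w) = 1).

Local Notation vec x := (x : 'rV[R]_d).

Let mxi k : measurable_fun [set: T] (xi k). Proof. by case: (hunif k). Qed.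

Lemma integral_probability_cst (c : \bar R) : (\int[P]_w c = c)%E.
Proof.
by rewrite integral_cst// (_ : _ setT = 1%E) ?mule1//; exact: probability_setT.
Qed.

(** Averaging the integrands for [xi k] and [- xi k], which have the same law, cancels the cross
    term pointwise. *)
Let integral_nsq_add k v (a : R) :
  (\int[P]_w (nsq (v + a *: vec (xi k w)))%:E = (nsq v + a ^+ 2)%:E)%E.
Proof.
set I := LHS; pose c := nsq v + a ^+ 2.
have m (b : R) : coord_measurable (fun x : borel_vec R d => v + b *: vec x).
  apply: coord_measurableD; first exact: coord_measurable_cst.
  by apply: coord_measurableZ; exact: coord_measurable_id.
have m' (b : R) : measurable_fun setT (fun w => (nsq (v + b *: vec (xi k w)))%:E).
  apply/measurable_EFinP; apply: measurable_nsq.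
  by apply: (coord_measurable_comp (mxi k) (m b)).
have N1 : (- 1%:M : 'M[R]_d) *m (- 1%:M)^T = 1%:M.
  by rewrite linearN/= trmx1 mulmxN mulNmx opprK mulmx1.
have IN : I = (\int[P]_w (nsq (v + - a *: vec (xi k w)))%:E)%E.
  have mh : measurable_fun [set: borel_vec R d]
      (fun x => (nsq (v + a *: vec x))%:E).
    by apply/measurable_EFinP; exact: measurable_nsq.
  apply: (eq_trans (esym (ge0_integral_uniform_mulO (hunif k) N1 mh _))).
    by move=> x; rewrite lee_fin nsq_ge0.
  by apply: eq_integral => w _; rewrite mulmxN mulmx1 scalerN scaleNr.
have II : (I + I = (2 * c)%:E)%E.
  rewrite {2}IN /I -ge0_integralD//; last 2 first.
  - by move=> w _; rewrite lee_fin nsq_ge0.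
  - by move=> w _; rewrite lee_fin nsq_ge0.
  rewrite -[RHS]integral_probability_cst; apply: eq_integral => w _.
  rewrite -EFinD !nsqD !nsqZ sxi scaleNr dotNr sqrrN /c; congr EFin; ring.
have I0 : (0 <= I)%E by apply: integral_ge0 => w _; rewrite lee_fin nsq_ge0.
case: I I0 II {IN} => [r _|_ //|//].
by rewrite -EFinD => -[] rr; congr EFin; rewrite -/c; lra.
Qed.

(** Induction on [n]: the last vector is decoupled from the preceding ones and integrated first. *)
Lemma integral_nsq_lin_comb n a :
  (\int[P]_w (nsq (lin_comb xi n a w))%:E = (\sum_(k < n) a k ^+ 2)%:E)%E.
Proof.
elim: n => [|n IH].
  rewrite big_ord0 -[RHS]integral_probability_cst; apply: eq_integral => w _.
  by rewrite /lin_comb big_ord0; congr EFin; apply/eqP; rewrite nsq_eq0.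
have off k : k != n -> coord_measurable
    (fun w : g_sigma_algebraType (cylinders_off xi n) => vec (xi k w)).
  by move=> kn; apply: coord_measurable_vec; exact: measurable_cylinders_off.
have moff : coord_measurable (fun w : g_sigma_algebraType (cylinders_off xi n) =>
    lin_comb xi n a w).
  apply: coord_measurable_sum => k _; apply: coord_measurableZ.
  by apply: off; rewrite ltn_eqF.
have mlin : coord_measurable (lin_comb xi n a).
  apply: coord_measurable_sum => k _; apply: coord_measurableZ.
  exact: coord_measurable_vec.
pose h (z : g_sigma_algebraType (cylinders_off xi n) * borel_vec R d) :=
  (nsq (lin_comb xi n a z.1 + a n *: vec z.2))%:E.
have mh : measurable_fun setT h.
  apply/measurable_EFinP; apply: measurable_nsq; apply: coord_measurableD.
    exact: (@coord_measurable_comp _ _ _ _ _ _ _ fst _ moff).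
  apply: coord_measurableZ.
  apply: (@coord_measurable_comp _ _ _ _ _ _
    (fun x : borel_vec R d => vec x) snd) => //.
  exact: coord_measurable_id.
transitivity (\int[P]_w h (w, xi n w))%E.
  by apply: eq_integral => w _; rewrite /lin_comb big_ord_recr.
rewrite (ge0_integral_independent mxi hindep mh); last first.
  by move=> z; rewrite lee_fin nsq_ge0.
rewrite /h/=; under eq_integral do rewrite integral_nsq_add EFinD.
rewrite ge0_integralD//; last 3 first.
- by move=> w _; rewrite lee_fin nsq_ge0.
- by apply/measurable_EFinP; exact: measurable_nsq.
- by move=> w _; rewrite lee_fin sqr_ge0.
by rewrite IH integral_probability_cst -EFinD big_ord_recr.
Qed.

End SecondMoment.

Section Qnorm.
Context {disp : measure_display} {T : measurableType disp} {R : realType}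
  {d : nat}.
Variable P : probability T R.
Implicit Types X Y : T -> 'rV[R]_d.

Lemma measurable_epow_enorm (q : R) X : q < 0 -> coord_measurable X ->
  measurable_fun [set: T] (fun w => epow (enorm (X w))%:E q).
Proof.
move=> q0 mX.
apply: (emeasurable_fun_cvg (fun m w => regpow m.+1%:R^-1 (q / 2) (X w))).
  by move=> m; exact: measurable_regpow.
by move=> w _; exact: regpow_cvg.
Qed.

Lemma epow2_enorm (x : 'rV[R]_d) : epow (enorm x)%:E 2 = (nsq x)%:E.
Proof.
by rewrite /epow ltNge ler0n/= powR_mulrn ?sqrtr_ge0// sqr_enorm.
Qed.

Lemma qnorm_ge0 (q : R) X : (0 <= qnorm P q X)%E.
Proof. exact: epow_ge0. Qed.

Lemma qnorm_ae_eq (q : R) X Y : q < 0 \/ q = 2 ->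
  coord_measurable X -> coord_measurable Y ->
  {ae P, forall w, X w = Y w} -> qnorm P q X = qnorm P q Y.
Proof.
move=> q02 mX mY XY.
have m (Z : T -> 'rV[R]_d) : coord_measurable Z ->
    measurable_fun [set: T] (fun w => epow (enorm (Z w))%:E q).
  move=> mZ; case: q02 => [q0|->]; first exact: measurable_epow_enorm.
  under eq_fun do rewrite epow2_enorm.
  by apply/measurable_EFinP; exact: measurable_nsq.
suff E : (\int[P]_w epow (enorm (X w))%:E q = \int[P]_w epow (enorm (Y w))%:E q)%E.
  by rewrite /qnorm E.
apply: ae_eq_integral; [exact: measurableT|exact: m|exact: m|].
by apply: filterS XY => w XYw _; rewrite /= XYw.
Qed.

Lemma qnormZ (q t : R) X : q < 0 -> 0 < t -> coord_measurable X ->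
  qnorm P q (fun w => t *: X w) = (t%:E * qnorm P q X)%E.
Proof.
move=> q0 t0 mX; rewrite /qnorm.
have -> : (\int[P]_w epow (enorm (t *: X w))%:E q =
    (t `^ q)%:E * \int[P]_w epow (enorm (X w))%:E q)%E.
  rewrite -ge0_integralZl//; last 3 first.
  - exact: measurable_epow_enorm.
  - by move=> w _; exact: epow_ge0.
  - by rewrite lee_fin powR_ge0.
  apply: eq_integral => w _; rewrite !epow_enorm// nsqZ mulf_eq0 sqrf_eq0.
  rewrite (gt_eqF t0)/=; case: ifPn => _.
    by rewrite gt0_muley// lte_fin powR_gt0.
  rewrite -EFinM powRM ?nsq_ge0 ?sqr_ge0//; congr (_ * _)%:E.
  rewrite -powR_mulrn ?ltW// -powRrM; congr (_ `^ _).
  by rewrite mulrCA divff// mulr1.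
set I := (\int[P]_w _)%E.
have I0 : (0 <= I)%E by apply: integral_ge0 => w _; exact: epow_ge0.
rewrite /epow invr_lt0 q0 poweRM//; last by rewrite lee_fin powR_ge0.
rewrite poweR_EFin -powRrM mulrN divff ?lt_eqF// powRN powRr1 ?ltW//.
(* [J] is the reciprocal of the norm; its values 0 and [+oo] are the norms [+oo] and 0. *)
set J := (I `^ _)%E.
have : (0 <= J)%E by exact: poweR_ge0.
case: J => [r| |//] r0.
  rewrite -EFinM !inver mulf_eq0 invr_eq0 (gt_eqF t0)/=.
  by case: ifPn => _; rewrite ?gt0_muley ?lte_fin// -EFinM invfM invrK.
by rewrite gt0_muley ?lte_fin ?invr_gt0// invey mule0.
Qed.

End Qnorm.

(** * The best constant for vectors lying everywhere on the sphere *)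

Section OnSphere.
Context {disp : measure_display} {T : measurableType disp} {R : realType}
  {d : nat}.
Variables (P : probability T R) (xi : nat -> T -> borel_vec R d) (q : R).
Hypotheses (hq : - (d%:R - 4) <= q) (hq0 : q < 0)
  (hunif : forall k, uniform_on_sphere P (xi k))
  (hindep : mutually_independent P xi)
  (sxi : forall k w, nsq (xi k w) = 1).

Let mxi k : coord_measurable (xi k).
Proof. by case: (hunif k) => /coord_measurable_vec. Qed.

Let mlin n a : coord_measurable (lin_comb xi n a).
Proof. by apply: coord_measurable_sum => k _; apply: coord_measurableZ. Qed.

Let qnorm_uniform_le n (a : nat -> R) (mu : R) : 0 <= mu -> (0 < n)%N ->
  \sum_(k < n) a k ^+ 2 = n%:R * mu ^+ 2 ->
  (qnorm P q (lin_comb xi n (fun=> mu)) <= qnorm P q (lin_comb xi n a))%E.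
Proof.
move=> mu0 n0 sa.
have q0 := hq0; have dq := hq.
have p0 : q / 2 < 0 by rewrite pmulr_llt0 ?invr_gt0.
have dp : 4 <= d%:R + 2 * (q / 2) by rewrite mulrCA divff// mulr1; lra.
(* The outer exponent [1/q] is negative, so maximal expectation means minimal norm. *)
apply: epow_le_lt0; first by rewrite invr_lt0.
  by apply: integral_ge0 => w _; exact: epow_ge0.
pose g m w := regpow m.+1%:R^-1 (q / 2) (lin_comb xi n a w).
have g_cvg : (\int[P]_w g m w @[m --> \oo] -->
    \int[P]_w epow (enorm (lin_comb xi n a w))%:E q)%E.
  have -> : (\int[P]_w epow (enorm (lin_comb xi n a w))%:E q =
      \int[P]_w (limn (g ^~ w)))%E.
    by apply: eq_integral => w _; apply/esym/cvg_lim => //; exact: regpow_cvg.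
  apply: cvg_monotone_convergence.
  - exact: measurableT.
  - by move=> m; exact: measurable_regpow.
  - by move=> m w _; exact: regpow_ge0.
  - move=> w _ m m' mm'; apply: regpow_le => //.
    by rewrite lef_pV2 ?posrE// ler_nat ltnS.
rewrite -(cvg_lim _ g_cvg)//; apply: lime_le; first exact: cvgP g_cvg.
apply: nearW => m.
have e0 : 0 < m.+1%:R^-1 :> R by rewrite invr_gt0.
(* The limit is taken on the side of [a] only; on the side of equal coefficients the pointwise bound
   [regpow_le_epow] is enough. *)
apply: le_trans (regmean_le_uniform hunif hindep sxi e0 p0 dp mu0 n0 sa) _.
apply: ge0_le_integral; first exact: measurableT.
- by move=> w _; exact: regpow_ge0.
- exact: measurable_regpow.
- exact: measurable_epow_enorm.
- by move=> w _; exact: regpow_le_epow.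
Qed.

Let qnorm2 n a : qnorm P 2 (lin_comb xi n a) =
  (Num.sqrt (\sum_(k < n) a k ^+ 2))%:E.
Proof.
rewrite /qnorm; under eq_integral do rewrite epow2_enorm.
rewrite integral_nsq_lin_comb// /epow invr_lt0 ltrn0 poweR_EFin.
by rewrite powR12_sqrt// sumr_ge0// => k _; exact: sqr_ge0.
Qed.

Let normalizedE n : normalized_norm P xi q n =
  qnorm P q (lin_comb xi n (fun=> (Num.sqrt n%:R)^-1)).
Proof.
rewrite /normalized_norm (_ : (fun w => _) =
  lin_comb xi n (fun=> (Num.sqrt n%:R)^-1))//.
by apply/funext => w; rewrite scaler_sumr.
Qed.

Let sqr_invsqrt n : ((Num.sqrt n%:R)^-1) ^+ 2 = n%:R^-1 :> R.
Proof. by rewrite exprVn sqr_sqrtr. Qed.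

(** The index starts at 1, since the empty sum has norm 0 and would break monotonicity. *)
Let normalized_nonincreasing :
  {homo (fun n => normalized_norm P xi q n.+1) : n m / (n <= m)%N >-> (m <= n)%E}.
Proof.
apply/nonincreasing_seqP => n; rewrite !normalizedE.
pose a (k : nat) : R := if (k < n.+1)%N then (Num.sqrt n.+1%:R)^-1 else 0.
have -> : lin_comb xi n.+1 (fun=> (Num.sqrt n.+1%:R)^-1) = lin_comb xi n.+2 a.
  apply/funext => w; rewrite /lin_comb [RHS]big_ord_recr/= {2}/a ltnn scale0r addr0.
  by apply: eq_bigr => k _; rewrite /a ltn_ord.
apply: qnorm_uniform_le => //.
rewrite sqr_invsqrt divff ?pnatr_eq0// big_ord_recr/= {2}/a ltnn expr0n addr0.
under eq_bigr => k _ do rewrite /a ltn_ord sqr_invsqrt.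
by rewrite sumr_const card_ord -[LHS]mulr_natr mulVf ?pnatr_eq0.
Qed.

Lemma sphere_normalized_cvg : cvgn (normalized_norm P xi q).
Proof.
move: normalized_nonincreasing; move: (normalized_norm P xi q) => u u_noninc.
have h := ereal_nonincreasing_cvgn u_noninc.
by apply: (cvgP (ereal_inf (range (fun n => u n.+1)))); rewrite -cvg_shiftS.
Qed.

Let lim_le n : (0 < n)%N ->
  (khinchin_const_infty P xi q <= normalized_norm P xi q n)%E.
Proof.
move: sphere_normalized_cvg normalized_nonincreasing.
rewrite /khinchin_const_infty; move: (normalized_norm P xi q) => u cu u_noninc.
case: n => // n _; apply: lime_le => //.
by exists n.+1 => // -[//|m] /= nm; exact: u_noninc.
Qed.

(** Equal coefficients [mu] with the same sum of squares [s^2] give [s] times a normalized norm,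
    which lies above the limit. *)
Let bound_of_le_lim (c : R) : (c%:E <= khinchin_const_infty P xi q)%E ->
  khinchin_bound P xi q c.
Proof.
move=> cl n a n0; rewrite qnorm2.
set s := Num.sqrt _; have s0 : 0 <= s by exact: sqrtr_ge0.
have s2 : s ^+ 2 = \sum_(k < n) a k ^+ 2.
  by rewrite sqr_sqrtr// sumr_ge0// => k _; exact: sqr_ge0.
move: s0; rewrite le_eqVlt => /predU1P[<-|s0]; first by rewrite mule0 qnorm_ge0.
have nR : 0 < n%:R :> R by rewrite ltr0n.
pose mu := s / Num.sqrt n%:R.
have mu0 : 0 <= mu by rewrite divr_ge0 ?sqrtr_ge0 ?ltW.
have sa : \sum_(k < n) a k ^+ 2 = n%:R * mu ^+ 2.
  by rewrite /mu exprMn sqr_invsqrt -s2 mulrCA divff ?mulr1// gt_eqF.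
apply: le_trans (qnorm_uniform_le mu0 n0 sa).
have -> : lin_comb xi n (fun=> mu) =
    fun w => s *: lin_comb xi n (fun=> (Num.sqrt n%:R)^-1) w.
  apply/funext => w; rewrite /lin_comb scaler_sumr.
  by apply: eq_bigr => k _; rewrite scalerA.
rewrite qnormZ// -normalizedE muleC.
by apply: lee_wpmul2l; [rewrite lee_fin ltW|exact: le_trans cl (lim_le n0)].
Qed.

(** An admissible [c] is tested on coefficients [1 / sqrt n], whose combination has 2-norm 1, and
    [n] tends to infinity; conversely [bound_of_le_lim] makes every real up to the limit
    admissible. *)
Lemma sphere_khinchin_const :
  khinchin_const P xi q = khinchin_const_infty P xi q.
Proof.
apply/eqP; rewrite eq_le; apply/andP; split.
  apply: ge_ereal_sup => _ [c cb <-].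
  apply: lime_ge; first exact: sphere_normalized_cvg.
  exists 1%N => // n /= n0; rewrite normalizedE.
  have := cb n (fun=> (Num.sqrt n%:R)^-1) n0; rewrite qnorm2.
  rewrite sumr_const card_ord sqr_invsqrt -[X in Num.sqrt X]mulr_natr.
  by rewrite mulVf ?pnatr_eq0 -?lt0n// sqrtr1 mule1.
have l0 : (0 <= khinchin_const_infty P xi q)%E.
  apply: lime_ge; first exact: sphere_normalized_cvg.
  by apply: nearW => n; exact: qnorm_ge0.
have B := bound_of_le_lim.
(* The supremum runs over real constants: a finite limit is itself one of them, while under an
   infinite limit every real is admissible. *)
case: (khinchin_const_infty P xi q) l0 B => [r _ B| _ B|//].
  by apply: ereal_sup_ubound; exists r => //; exact: B.
rewrite leye_eq; apply/eqP/eqyP => A _.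
by apply: ereal_sup_ubound; exists A => //; apply: B; exact: leey.
Qed.

End OnSphere.

(** * From almost surely to everywhere on the sphere *)

Lemma ae_eq_probability {disp : measure_display} {T : measurableType disp}
    {R : realType} (P : probability T R) (A B : set T) :
  measurable A -> measurable B -> {ae P, forall w, A w <-> B w} -> P A = P B.
Proof.
move=> mA mB AB.
rewrite -[A]setIT -[B]setIT -!integral_indic//.
apply: ae_eq_integral => //; try exact/measurable_EFinP/measurable_indic.
apply: filterS AB => w ABw _; rewrite !indicE; congr (_%:R%:E).
by congr nat_of_bool; apply/idP/idP; rewrite !inE => /ABw.
Qed.

Section ReductionToSphere.
Context {disp : measure_display} {T : measurableType disp} {R : realType}
  {d : nat}.
Variables (P : probability T R) (xi : nat -> T -> borel_vec R d)
  (e : 'rV[R]_d).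
Hypotheses (hunif : forall k, uniform_on_sphere P (xi k))
  (hindep : mutually_independent P xi) (e1 : nsq e = 1).

Local Notation vec x := (x : 'rV[R]_d).

(** [uniform_on_sphere] yields unit norm only almost surely. Replacing the exceptional values by a
    fixed unit vector [e] gives it at every sample point, as the pointwise estimates require, and
    changes neither laws nor norms. *)
Definition on_sphere (k : nat) (w : T) : borel_vec R d :=
  if nsq (vec (xi k w)) == 1 then xi k w else e.

Lemma nsq_on_sphere k w : nsq (on_sphere k w) = 1.
Proof. by rewrite /on_sphere; case: eqP. Qed.

Let mxi k : measurable_fun [set: T] (xi k). Proof. by case: (hunif k). Qed.

Let mon k : measurable_fun [set: T] (on_sphere k).
Proof.
apply: measurable_fun_ifT => //; apply: measurable_fun_eqr => //.
by apply: measurable_nsq; exact: coord_measurable_vec.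
Qed.

Lemma ae_on_sphere : {ae P, forall w, forall k, on_sphere k w = xi k w}.
Proof.
apply: ae_foralln => k.
have mS : measurable (xi k @^-1` @sphere R d).
  rewrite (_ : _ @^-1` _ = [set: T] `&` (fun w => nsq (vec (xi k w))) @^-1` [set 1]).
    apply: measurable_nsq => //; exact: coord_measurable_vec.
  by rewrite setTI; apply/seteqP; split=> w /sphereP.
exists (~` (xi k @^-1` @sphere R d)); split.
- exact: measurableC.
- apply: (eq_trans (probability_setC P mS)).
  by case: (hunif k) => _ -> _; rewrite subee.
- move=> w /=; apply: contra_not => /sphereP x1.
  by rewrite /on_sphere x1 eqxx.
Qed.

Let mpre (X : T -> borel_vec R d) B :
  measurable_fun [set: T] X -> measurable B -> measurable (X @^-1` B).
Proof. by move=> mX mB; rewrite -[_ @^-1` _]setTI; exact: mX. Qed.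

Let P_on_sphere k B : measurable B -> P (on_sphere k @^-1` B) = P (xi k @^-1` B).
Proof.
move=> mB; apply: ae_eq_probability; [exact: mpre|exact: mpre|].
by apply: filterS ae_on_sphere => w E; rewrite /preimage/= E.
Qed.

Lemma uniform_on_sphere_on_sphere k : uniform_on_sphere P (on_sphere k).
Proof.
have [_ _ rot] := hunif k; split; first exact: mon.
- rewrite (_ : _ @^-1` _ = setT) ?probability_setT//.
  by apply/seteqP; split=> w // _; apply/sphereP; exact: nsq_on_sphere.
- move=> O OO B mB; rewrite P_on_sphere// -(rot _ OO _ mB).
  apply: ae_eq_probability.
  + exact: (mpre (measurableT_comp (measurable_mulmxr O) (mon k)) mB).
  + exact: (mpre (measurableT_comp (measurable_mulmxr O) (mxi k)) mB).
  by apply: filterS ae_on_sphere => w E; rewrite /= E.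
Qed.

Lemma independent_on_sphere : mutually_independent P on_sphere.
Proof.
move=> J B mB.
rewrite (eq_big_seq (fun j => P (xi j @^-1` B j))); last first.
  by move=> j jJ; rewrite P_on_sphere//; exact: mB.
rewrite -hindep//; apply: ae_eq_probability.
- apply: fin_bigcap_measurable => [|j jJ]; first exact: finite_fset.
  by apply: mpre => //; exact: mB.
- apply: fin_bigcap_measurable => [|j jJ]; first exact: finite_fset.
  by apply: mpre => //; exact: mB.
apply: filterS ae_on_sphere => w E.
by split=> h j /= jJ; have := h j jJ; rewrite /preimage/= E.
Qed.

Lemma qnorm_on_sphere (q : R) n a : q < 0 \/ q = 2 ->
  qnorm P q (lin_comb on_sphere n a) = qnorm P q (lin_comb xi n a).
Proof.
move=> q02; apply: qnorm_ae_eq => //.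
- apply: coord_measurable_sum => k _; apply: coord_measurableZ.
  exact: coord_measurable_vec.
- apply: coord_measurable_sum => k _; apply: coord_measurableZ.
  exact: coord_measurable_vec.
apply: filterS ae_on_sphere => w E.
by apply: eq_bigr => k _; rewrite E.
Qed.

End ReductionToSphere.

Theorem theorem1 (R : realType) (d : nat) (q : R)
    (disp : measure_display) (T : measurableType disp) (P : probability T R)
    (xi : nat -> T -> borel_vec R d)
    (hd : (5 <= d)%N)
    (hq : - (d%:R - 4) <= q) (hq0 : q < 0)
    (hunif : forall k, uniform_on_sphere P (xi k))
    (hindep : mutually_independent P xi) :
  cvgn (normalized_norm P xi q) /\
  khinchin_const P xi q = khinchin_const_infty P xi q.
Proof.
have d0 : (0 < d)%N by exact: leq_trans hd.
pose i0 := Ordinal d0.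
have [e e1] : exists e : 'rV[R]_d, nsq e = 1.
  exists (delta_mx ord0 i0); rewrite /nsq (bigD1 i0)//= mxE !eqxx expr1n.
  by rewrite big1 ?addr0// => j ji; rewrite mxE (negbTE ji) andbF expr0n.
(* The constant, the limit and the convergence depend on the vectors only through [qnorm] of linear
   combinations with exponents [q] and 2, so they carry over from [xi'] to [xi]. *)
have [xi' [uxi' ixi' sxi' QE]] : exists xi' : nat -> T -> borel_vec R d,
    [/\ forall k, uniform_on_sphere P (xi' k), mutually_independent P xi',
      forall k w, nsq (xi' k w) = 1 & forall r n a, r < 0 \/ r = 2 ->
      qnorm P r (lin_comb xi' n a) = qnorm P r (lin_comb xi n a)].
  exists (on_sphere xi e); split.
  - exact: uniform_on_sphere_on_sphere.
  - exact: independent_on_sphere.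
  - by move=> k w; exact: nsq_on_sphere.
  - exact: qnorm_on_sphere.
have nE : normalized_norm P xi q = normalized_norm P xi' q.
  apply/funext => n.
  have E (x : nat -> T -> borel_vec R d) : normalized_norm P x q n =
      qnorm P q (lin_comb x n (fun=> (Num.sqrt n%:R)^-1)).
    rewrite /normalized_norm (_ : (fun w => _) =
      lin_comb x n (fun=> (Num.sqrt n%:R)^-1))//.
    by apply/funext => w; rewrite scaler_sumr.
  by rewrite !E (QE q)//; left.
have bE c : khinchin_bound P xi q c <-> khinchin_bound P xi' q c.
  rewrite /khinchin_bound.
  by split=> h n a n0; have := h n a n0;
    rewrite (QE q n a (or_introl hq0)) (QE 2 n a (or_intror erefl)).
have kE : khinchin_const P xi q = khinchin_const P xi' q.
  apply: (congr1 (fun A : set R => ereal_sup [set c%:E | c in A])).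
  by apply/seteqP; split=> c h; [exact: (bE c).1|exact: (bE c).2].
rewrite /khinchin_const_infty nE kE; split.
  exact: sphere_normalized_cvg.
exact: sphere_khinchin_const.
Qed.
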